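(* Let $\Omega\subset\mathbb R^3$ be a bounded polyhedral domain with a quasi-uniform family of tetrahedral triangulations $\mathcal T_h$, and let $\epsilon\in[0,1]$. Let $A_{\operatorname{curl}}$, $A_{\operatorname{grad}}$, $A_{\operatorname{grad}^3}$, $D_{\operatorname{curl}}$, $\Pi_h^{\operatorname{curl}}$ be as defined in the context, and define the Hiptmair--Xu preconditioner by $$B_{\operatorname{curl}}=D_{\operatorname{curl}}^{-1}+\Pi_h^{\operatorname{curl}}A_{\operatorname{grad}^3}^{-1}(\Pi_h^{\operatorname{curl}})^t+\epsilon^{-1}\operatorname{grad}A_{\operatorname{grad}}^{-1}\operatorname{grad}^t\quad\text{if }\epsilon>0,$$ $$B_{\operatorname{curl}}=D_{\operatorname{curl}}^{-1}+\Pi_h^{\operatorname{curl}}A_{\operatorname{grad}^3}^{-1}(\Pi_h^{\operatorname{curl}})^t\quad\text{if }\epsilon=0.$$ Assume the discrete regular decomposition property: there is a constant $C_R$, independent of the mesh, such that for every $v_h\in H_h(\operatorname{curl})$ there exist $\tilde v_h\in H_h(\operatorname{curl})$, $\psi_h\in H_h(\operatorname{grad})^3$ and $p_h\in H_h(\operatorname{grad})$ with $$v_h=\tilde v_h+\Pi_h^{\operatorname{curl}}\psi_h+\operatorname{grad}p_h,$$ $$\|h^{-1}\tilde v_h\|_{L^2}^2+\|\psi_h\|_{H^1}^2\le C_R\|\operatorname{curl}v_h\|_{L^2}^2,\qquad \|p_h\|_{H^1}^2\le C_R\|v_h\|_{H(\operatorname{curl})}^2.$$ Then there is a constant $C$,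 independent of the mesh size and of $\epsilon\in[0,1]$, such that, whenever $A_{\operatorname{curl}}\ne0$, $$\kappa(B_{\operatorname{curl}}A_{\operatorname{curl}})\le C.$$
   Context: Finite element spaces on $\mathcal T_h$, all with homogeneous essential boundary conditions on $\partial\Omega$ (conforming in $H_0(\mathsf D;\Omega)$): $H_h(\operatorname{grad})\subset H_0^1(\Omega)$ is the space of continuous piecewise linear functions; $H_h(\operatorname{curl})\subset H_0(\operatorname{curl};\Omega)$ is the lowest-order Nédélec edge element space. $h\in L^\infty(\Omega)$ is the piecewise constant mesh diameter function. For $\mathsf D\in\{\operatorname{grad},\operatorname{curl}\}$, $A_{\mathsf D}$ is the operator (stiffness matrix) on $H_h(\mathsf D)$ of the bilinear form $(\mathsf Du,\mathsf Dv)_{L^2}+\epsilon(u,v)_{L^2}$; $A_{\operatorname{grad}^3}$ is that of $(\operatorname{grad}\psi,\operatorname{grad}\varphi)_{L^2}+\epsilon(\psi,\varphi)_{L^2}$ on vector fields $H_h(\operatorname{grad})^3$. Operators may be identified with matrices in the nodal bases with Euclidean inner products, and $^t$ denotes the adjoint (transpose); $\operatorname{grad}$ is regarded as a map $H_h(\operatorname{grad})\to H_h(\operatorname{curl})$. $D_{\operatorname{curl}}$ is the diagonal of $A_{\operatorname{curl}}$ in the standard edge basis of $H_h(\operatorname{curl})$ ($D_{\operatorname{curl}}^{-1}$ is the nodal Jacobi smoother). $\Pi_h^{\operatorname{curl}}$ is the canonical interpolation into $H_h(\operatorname{curl})$ matching the degrees of freedom (edge tangential integrals), restricted to $H_h(\operatorname{grad})^3$;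 it satisfies $\|\Pi_h^{\operatorname{curl}}\psi_h\|_{L^2}\lesssim\|\psi_h\|_{L^2}$ for $\psi_h\in H_h(\operatorname{grad})^3$ and $\operatorname{curl}\Pi_h^{\operatorname{curl}}\psi_h=\Pi_h^{\operatorname{div}}\operatorname{curl}\psi_h$, with $\Pi_h^{\operatorname{div}}$ the canonical interpolation into the lowest-order Raviart--Thomas space. $\|v\|_{H(\operatorname{curl})}^2=\|v\|_{L^2}^2+\|\operatorname{curl}v\|_{L^2}^2$. $\kappa(BA)=\lambda_{\max}(BA)/\lambda_{\min}(BA)$, where $\lambda_{\max}$ is the largest eigenvalue and $\lambda_{\min}$ the smallest nonzero eigenvalue of $BA$. Quasi-uniform means shape-regular with all element diameters comparable, with uniform constants; $C$ may depend on $\Omega$, on these constants and on $C_R$. *)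

(* Defs.v *)
From HB Require Import structures.
From mathcomp Require Import all_boot all_order all_algebra.
From mathcomp Require Import all_classical all_reals all_analysis.

Set Implicit Arguments.
Unset Strict Implicit.
Unset Printing Implicit Defensive.

Import Order.TTheory GRing.Theory Num.Theory.
Import numFieldTopology.Exports numFieldNormedType.Exports.

Local Open Scope classical_set_scope.
Local Open Scope ring_scope.

Section Euclidean.
Context {R : realType}.
Implicit Types x y : 'rV[R]_3.

Definition dotv x y : R := \sum_i x 0 i * y 0 i.
Definition enorm x : R := Num.sqrt (dotv x x).

(* Indices in 'I_3 are added modulo 3. *)
Definition crossv x y : 'rV[R]_3 :=
  \row_i (x 0 (i + 1) * y 0 (i + 2%:R) - x 0 (i + 2%:R) * y 0 (i + 1)).

Definition partial (i : 'I_3) (f : 'rV[R]_3 -> R) x : R :=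
  'D_(delta_mx 0 i) f x.

Definition gradf (f : 'rV[R]_3 -> R) x : 'rV[R]_3 := \row_i partial i f x.

Definition curlf (v : 'rV[R]_3 -> 'rV[R]_3) x : 'rV[R]_3 :=
  \row_i (partial (i + 1) (fun y => v y 0 (i + 2%:R)) x
          - partial (i + 2%:R) (fun y => v y 0 (i + 1)) x).

(* The library has no measure on 'rV[R]_3: integrate over the product space
   R * R * R, identified with 'rV[R]_3 through its coordinates. *)
Definition point_of (p : R * R * R) : 'rV[R]_3 :=
  \row_(i < 3) [:: p.1.1; p.1.2; p.2]`_i.

Definition integral3 (K : set 'rV[R]_3) (f : 'rV[R]_3 -> R) : R :=
  \int[((@lebesgue_measure R \x @lebesgue_measure R) \x @lebesgue_measure R)%E]_(p
     in point_of @^-1` K) f (point_of p).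

Definition diam (K : set 'rV[R]_3) : R :=
  sup [set d | exists x y, [/\ K x, K y & d = enorm (x - y)]].

Definition hull n (p : 'I_n -> 'rV[R]_3) (A : {set 'I_n}) : set 'rV[R]_3 :=
  [set x | exists c : 'I_n -> R,
     [/\ forall i, 0 <= c i, forall i, i \notin A -> c i = 0,
         \sum_i c i = 1 & x = \sum_i c i *: p i]].

Definition affinely_independent n (p : 'I_n -> 'rV[R]_3) (A : {set 'I_n}) :=
  forall c : 'I_n -> R, (forall i, i \notin A -> c i = 0) ->
    \sum_i c i = 0 -> \sum_i c i *: p i = 0 -> forall i, c i = 0.

Definition bdry (Om : set 'rV[R]_3) : set 'rV[R]_3 := closure Om `\` Om^°.

(* The boundary is a finite union of nondegenerate closed triangles;
   no Lipschitz condition is imposed. *)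
Definition polyhedral_domain (Om : set 'rV[R]_3) :=
  [/\ Om !=set0, open Om, connected Om, bounded_set Om &
      exists (n : nat) (f : 'I_n -> 'I_3 -> 'rV[R]_3),
        (forall k, affinely_independent (f k) [set: 'I_3]%SET) /\
        bdry Om = \bigcup_k hull (f k) [set: 'I_3]%SET].

End Euclidean.

Record mesh (R : realType) := Mesh {
  nvert : nat;
  ntet : nat;
  vert : 'I_nvert -> 'rV[R]_3;
  tet : 'I_ntet -> 'I_4 -> 'I_nvert }.

Section Mesh.
Context {R : realType}.
Variables (Om : set 'rV[R]_3) (M : mesh R).

Local Notation V := 'I_(nvert M).
Local Notation T := 'I_(ntet M).

Definition tverts (t : T) : {set V} := [set tet t k | k : 'I_4]%SET.

Definition simplex (A : {set V}) : set 'rV[R]_3 := hull (@vert R M) A.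

Definition elt (t : T) : set 'rV[R]_3 := simplex (tverts t).

Definition elt_diam (t : T) : R := diam (elt t).

(* Conforming triangulation of the domain by closed nondegenerate tetrahedra; the last
   clause, automatic when Om is the interior of its closure, says that the
   mesh resolves the boundary when Om has slits. *)
Definition triangulates :=
  [/\ injective (@vert R M) /\ (forall i : V, exists t, i \in tverts t),
      (forall t : T, injective (tet t) /\
                     affinely_independent (@vert R M) (tverts t)) /\
      injective tverts,
      forall t t' : T, elt t `&` elt t' = simplex (tverts t :&: tverts t')%SET,
      closure Om = \bigcup_t elt t &
      bdry Om = \bigcup_(F in [set F : {set V} |
                 [/\ #|F| = 3%N, exists t, F \subset tverts t &
                     simplex F `<=` bdry Om]]) simplex F].

Definition quasi_uniform_mesh (sigma tau : R) :=
  (forall t : T, exists (c : 'rV[R]_3) (r : R),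
     [/\ 0 < r, forall x, enorm (x - c) <= r -> elt t x &
         elt_diam t <= sigma * r]) /\
  (forall t t' : T, elt_diam t <= tau * elt_diam t').

(* Piecewise polynomial fields: one polynomial on the whole space per
   tetrahedron, of which only the restriction to that tetrahedron matters.
   As the tetrahedra overlap in null sets, integrals over the domain are sums of
   integrals over tetrahedra, and for conforming fields grad and curl are
   computed elementwise. *)
Definition sfield := T -> 'rV[R]_3 -> R.
Definition vfield := T -> 'rV[R]_3 -> 'rV[R]_3.

Definition comp (k : 'I_3) (v : vfield) : sfield := fun t x => v t x 0 k.
Definition grad (u : sfield) : vfield := fun t => gradf (u t).
Definition curl (v : vfield) : vfield := fun t => curlf (v t).

Definition sL2 (u v : sfield) : R :=
  \sum_t integral3 (elt t) (fun x => u t x * v t x).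
Definition vL2 (u v : vfield) : R :=
  \sum_t integral3 (elt t) (fun x => dotv (u t x) (v t x)).
Definition grad3L2 (u v : vfield) : R :=
  \sum_k vL2 (grad (comp k u)) (grad (comp k v)).

(* the square of the L2 norm of h^-1 v *)
Definition hinv_normsq (v : vfield) : R :=
  vL2 (fun t x => (elt_diam t)^-1 *: v t x)
      (fun t x => (elt_diam t)^-1 *: v t x).
Definition sH1_normsq (p : sfield) : R := sL2 p p + vL2 (grad p) (grad p).
Definition vH1_normsq (v : vfield) : R := vL2 v v + grad3L2 v v.
Definition Hcurl_normsq (v : vfield) : R := vL2 v v + vL2 (curl v) (curl v).

Definition Hgrad (u : sfield) :=
  [/\ forall t, exists (a : R) (b : 'rV[R]_3), forall x, u t x = a + dotv b x,
      forall t t' x, elt t x -> elt t' x -> u t x = u t' x &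
      forall t x, elt t x -> bdry Om x -> u t x = 0].

Definition Hgrad3 (v : vfield) := forall k, Hgrad (comp k v).

(* Lowest-order Nedelec space: fields a + b x on each tetrahedron (cross
   product), with tangential components continuous across common faces and
   edges and vanishing on the faces and edges contained in the boundary. *)
Definition Hcurl (v : vfield) :=
  [/\ forall t, exists a b : 'rV[R]_3, forall x, v t x = a + crossv b x,
      forall t t' x y z, (elt t `&` elt t') x -> (elt t `&` elt t') y ->
        (elt t `&` elt t') z -> dotv (v t x) (y - z) = dotv (v t' x) (y - z) &
      forall t (F : {set V}), F \subset tverts t -> simplex F `<=` bdry Om ->
        forall x y z, simplex F x -> simplex F y -> simplex F z ->
          dotv (v t x) (y - z) = 0].

Definition ivert := {i : V | @vert R M i \in Om}.

Definition is_iedge (e : V * V) : bool :=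
  [&& (e.1 < e.2)%N,
      [exists t, (e.1 \in tverts t) && (e.2 \in tverts t)] &
      ~~ `[< simplex [set e.1; e.2]%SET `<=` bdry Om >]].
Definition iedge := {e : V * V | is_iedge e}.

(* Row k of the matrix is (1, coordinates of vertex k of t). *)
Definition bary (t : T) (k : 'I_4) (x : 'rV[R]_3) : R :=
  let P : 'M[R]_4 := \matrix_(l < 4) row_mx 1 (vert (tet t l)) in
  ((row_mx 1 x : 'rV[R]_4) *m invmx P) 0 k.

(* barycentric coordinate of the vertex i on t, zero if i is not in t *)
Definition lam (i : V) : sfield :=
  fun t x => \sum_(k | tet t k == i) bary t k x.

Definition hat (i : ivert) : sfield := lam (val i).

Definition hat3 (ik : ivert * 'I_3) : vfield :=
  fun t x => hat ik.1 t x *: delta_mx 0 ik.2.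

(* Whitney functions: the basis dual to [dof] *)
Definition whitney (e : iedge) : vfield :=
  let i := (val e).1 in let j := (val e).2 in
  fun t x => lam i t x *: grad (lam j) t x - lam j t x *: grad (lam i) t x.

(* Tangential integral along the edge e, computed from some tetrahedron that
   contains e; for the fields used here the choice is immaterial. *)
Definition dof (e : iedge) (v : vfield) : R :=
  let a := vert (val e).1 in let b := vert (val e).2 in
  if [pick t | ((val e).1 \in tverts t) && ((val e).2 \in tverts t)] is Some t
  then \int[lebesgue_measure]_(s in `[0, 1]%classic)
         dotv (v t (a + s *: (b - a))) (b - a)
  else 0.

Definition Pi_curl (v : vfield) : vfield :=
  fun t x => \sum_e dof e v *: whitney e t x.

Definition regular_decomposition (CR : R) :=
  forall v, Hcurl v -> exists (w psi : vfield) (p : sfield),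
    [/\ Hcurl w /\ Hgrad3 psi /\ Hgrad p,
        forall t x, v t x = w t x + Pi_curl psi t x + grad p t x,
        hinv_normsq w + vH1_normsq psi <= CR * vL2 (curl v) (curl v) &
        sH1_normsq p <= CR * Hcurl_normsq v].

Definition fmatrix (I J : finType) (f : I -> J -> R) : 'M[R]_(#|{: I}|, #|{: J}|) :=
  \matrix_(a < #|{: I}|, b < #|{: J}|) f (enum_val a) (enum_val b).

Definition A_curl (eps : R) : 'M[R]_(#|{: iedge}|) :=
  fmatrix (fun e e' : iedge => vL2 (curl (whitney e)) (curl (whitney e'))
                               + eps * vL2 (whitney e) (whitney e')).

Definition A_grad (eps : R) : 'M[R]_(#|{: ivert}|) :=
  fmatrix (fun i j : ivert => vL2 (grad (hat i)) (grad (hat j))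
                              + eps * sL2 (hat i) (hat j)).

Definition A_grad3 (eps : R) : 'M[R]_(#|{: ivert * 'I_3}|) :=
  fmatrix (fun i j : ivert * 'I_3 => grad3L2 (hat3 i) (hat3 j)
                                     + eps * vL2 (hat3 i) (hat3 j)).

Definition D_curl (eps : R) : 'M[R]_(#|{: iedge}|) :=
  diag_mx (\row_a A_curl eps a a).

(* Matrices of Pi_curl and grad, acting on columns of coefficients: the
   coordinates in the basis [whitney] are the values of [dof]. *)
Definition Pi_mx : 'M[R]_(#|{: iedge}|, #|{: ivert * 'I_3}|) :=
  fmatrix (fun (e : iedge) ik => dof e (hat3 ik)).

Definition grad_mx : 'M[R]_(#|{: iedge}|, #|{: ivert}|) :=
  fmatrix (fun (e : iedge) (i : ivert) => dof e (grad (hat i))).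

Definition B_curl (eps : R) : 'M[R]_(#|{: iedge}|) :=
  let B0 := invmx (D_curl eps) + Pi_mx *m invmx (A_grad3 eps) *m Pi_mx^T in
  if 0 < eps
  then B0 + eps^-1 *: (grad_mx *m invmx (A_grad eps) *m grad_mx^T)
  else B0.

End Mesh.

Section Kappa.
Context {R : realType}.

(* Real eigenvalues suffice: for A symmetric and B symmetric positive definite,
   B A is similar to a symmetric matrix. [eigenvalue] uses row eigenvectors,
   which give the same eigenvalues as columns. *)
Definition lambda_max n (M : 'M[R]_n) : R := sup [set a | eigenvalue M a].
Definition lambda_min n (M : 'M[R]_n) : R :=
  inf [set a | eigenvalue M a /\ a != 0].
Definition kappa n (M : 'M[R]_n) : R := lambda_max M / lambda_min M.

End Kappa.

Definition quasi_uniform_family (R : realType) (Om : set 'rV[R]_3)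
    (I : Type) (T : I -> mesh R) (sigma tau : R) :=
  forall i, triangulates Om (T i) /\ quasi_uniform_mesh (T i) sigma tau.

(* Main.v *)
(* For a nonzero eigenvalue a of B A there is u with B A u = a u, and a is the
   quotient of (B A u, A u) by (A u, u), so it suffices to compare these two
   quadratic forms. Each summand S K^-1 S^T of B contributes at most C (A u, u)
   as soon as S is bounded by sqrt C from the K-norm to the A-norm; conversely a
   splitting u = sum S z with sum (K z, z) <= C (A u, u) gives
   (A u, u) <= C (B A u, A u) by the Cauchy-Schwarz inequality. The splitting is
   the regular decomposition.

   The remaining bounds are local. On a tetrahedron containing a ball of radius r
   and of diameter h <= sigma r, barycentric coordinates have gradient at most
   1/r, and an affine function is bounded pointwise by its mean square over a
   cube inside the ball, so that no change of variables is needed. The bound for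
   the curl of the interpolant uses that constant fields are reproduced. *)
Require Import Defs.
From mathcomp Require Import all_boot all_order all_algebra.
From mathcomp Require Import all_classical all_reals all_analysis.
From mathcomp Require Import ring lra.

Set Implicit Arguments.
Unset Strict Implicit.
Unset Printing Implicit Defensive.

Import Order.TTheory GRing.Theory Num.Theory.
Import numFieldTopology.Exports numFieldNormedType.Exports.

Local Open Scope classical_set_scope.
Local Open Scope ring_scope.

(** * Subspace correction preconditioners *)

(** Uniformity in eps comes from matching weights. Since curl grad = 0, a gradient has energy eps
    times its squared L2 norm, so the third summand of B is the correction with K = eps A_grad, and
    its constant is 1. Interpolation bounds curl by gradient and mass by mass, so that eps weights
    both sides alike. The potential p of the splitting is controlled only by the full H(curl) norm,
    but it is measured with weight eps, and eps (|v|^2 + |curl v|^2) <= |curl v|^2 + eps |v|^2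
    because eps <= 1.

    At eps = 0 two things change. A_curl has the gradients in its kernel, so the abstract part asks
    only that A be semidefinite, and the gradient part of the splitting drops out of (A u, u), which
    is why two summands suffice. Moreover the inner matrices must still be invertible, since [invmx]
    returns a singular matrix unchanged: their definiteness has to come from the gradient and curl
    terms alone. For A_grad this is a qualitative Poincare inequality, obtained from an extremal
    vertex; for D_curl it is the fact that no Whitney function is curl free. *)

Section BilinearForm.
Context {R : realFieldType}.

Definition bform n (A : 'M[R]_n) (x y : 'cV[R]_n) : R := (x^T *m A *m y) 0 0.

Definition posdef n (A : 'M[R]_n) :=
  A^T = A /\ forall x, x != 0 -> 0 < bform A x x.

Lemma bformDl n (A : 'M[R]_n) x1 x2 y :
  bform A (x1 + x2) y = bform A x1 y + bform A x2 y.
Proof. by rewrite /bform linearD /= !mulmxDl mxE. Qed.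

Lemma bformZl n (A : 'M[R]_n) a x y : bform A (a *: x) y = a * bform A x y.
Proof. by rewrite /bform linearZ /= -!scalemxAl mxE. Qed.

Lemma bformDr n (A : 'M[R]_n) x y1 y2 :
  bform A x (y1 + y2) = bform A x y1 + bform A x y2.
Proof. by rewrite /bform mulmxDr mxE. Qed.

Lemma bformZr n (A : 'M[R]_n) a x y : bform A x (a *: y) = a * bform A x y.
Proof. by rewrite /bform -scalemxAr mxE. Qed.

Lemma bformDm n (A B : 'M[R]_n) x y :
  bform (A + B) x y = bform A x y + bform B x y.
Proof. by rewrite /bform mulmxDr mulmxDl mxE. Qed.

Lemma bformZm n a (A : 'M[R]_n) x y : bform (a *: A) x y = a * bform A x y.
Proof. by rewrite /bform -scalemxAr -scalemxAl mxE. Qed.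

Lemma bform_sum n (A : 'M[R]_n) x y :
  bform A x y = \sum_i \sum_j x i 0 * y j 0 * A i j.
Proof.
rewrite /bform mxE exchange_big; apply: eq_bigr => j _.
rewrite mxE big_distrl /=; apply: eq_bigr => i _.
by rewrite mxE mulrAC.
Qed.

Lemma bform_sym n (A : 'M[R]_n) x y : A^T = A -> bform A x y = bform A y x.
Proof.
move=> sA; rewrite /bform -[in RHS]sA -[LHS]trace_mx11 -[RHS]trace_mx11.
by rewrite -mxtrace_tr !trmx_mul !trmxK mulmxA.
Qed.

Lemma bform_ge0 n (A : 'M[R]_n) x : posdef A -> 0 <= bform A x x.
Proof.
move=> [_ pA]; have [->|/pA/ltW//] := eqVneq x 0.
by rewrite /bform mulmx0 mxE.
Qed.

(** A nonzero row vector in the kernel would give the form the value 0. *)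
Lemma posdef_unit n (A : 'M[R]_n) : posdef A -> A \in unitmx.
Proof.
move=> [_ pA]; rewrite -row_free_unit -kermx_eq0; apply/eqP/row_matrixP => i.
rewrite row0; set v := row i _.
have vA : v *m A = 0 by apply/sub_kermxP; rewrite row_sub.
apply/eqP; rewrite -trmx_eq0; apply: contraT => /pA.
by rewrite /bform trmxK vA mul0mx mxE ltxx.
Qed.

Lemma posdefZ n a (A : 'M[R]_n) : 0 < a -> posdef A -> posdef (a *: A).
Proof.
move=> a0 [sA pA]; split=> [|x /pA xA]; first by rewrite linearZ /= sA.
by rewrite bformZm mulr_gt0.
Qed.

(** Expand the form at t x - y and divide by t. This weighted Young inequality stands in for
    Cauchy-Schwarz, so that no square roots appear. *)
Lemma bform_young n (A : 'M[R]_n) (t : R) x y : A^T = A ->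
  (forall z, 0 <= bform A z z) -> 0 < t ->
  2 * bform A x y <= t * bform A x x + t^-1 * bform A y y.
Proof.
move=> sA pA t0; have := pA (t *: x + (-1) *: y).
rewrite !(bformDl, bformDr, bformZl, bformZr) (bform_sym y x sA) => h.
rewrite -(ler_pM2l t0) mulrDr [t * (t^-1 * _)]mulrA mulfV ?gt_eqF// mul1r.
by rewrite -subr_ge0; apply: le_trans h _; rewrite le_eqVlt; apply/orP; left;
  apply/eqP; ring.
Qed.

Lemma bform_mull m n (S : 'M[R]_(m, n)) (A : 'M[R]_m) x y :
  bform A (S *m x) y = (x^T *m (S^T *m (A *m y))) 0 0.
Proof. by rewrite /bform trmx_mul !mulmxA. Qed.

Section Correction.
Variables (m n : nat) (A : 'M[R]_n) (S : 'M[R]_(n, m)) (K : 'M[R]_m).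
Hypotheses (symA : A^T = A) (psdA : forall x, 0 <= bform A x x).
Hypothesis pdK : posdef K.

Local Notation corr := (S *m invmx K *m S^T).

(** The subspace correction of u: the solution of K z = S^T A u. *)
Let z (u : 'cV[R]_n) := invmx K *m (S^T *m (A *m u)).

Lemma correctionE u :
  bform corr (A *m u) (A *m u) = bform K (z u) (z u) /\
  bform corr (A *m u) (A *m u) = bform A (S *m z u) u.
Proof.
have uK := posdef_unit pdK; have [sK _] := pdK.
rewrite bform_mull /z; set y := A *m u; rewrite /bform.
by split; rewrite !trmx_mul trmxK trmx_inv sK !mulmxA ?mulmxKV.
Qed.

(** With q the left-hand side, q = (A u, S z), so Young with weight C gives 2 q <= C (A u, u) + C^-1
    (A S z, S z). The last term is at most (K z, z) = q. *)
Lemma correction_upper C u : 0 < C ->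
  (forall x, bform A (S *m x) (S *m x) <= C * bform K x x) ->
  bform corr (A *m u) (A *m u) <= C * bform A u u.
Proof.
move=> C0 hS; have [e1 e2] := correctionE u.
have := bform_young u (S *m z u) symA psdA C0.
have := hS (z u); rewrite -e1 (bform_sym u _ symA) -e2.
set q := bform corr _ _; rewrite -ler_pdivrMl// => h1 h2.
lra.
Qed.

(** By the choice of z, (A S x, u) = (K x, z); then Young in the K-form. The bound is additive over
    the parts of a splitting of u, with one common t. *)
Lemma correction_lower t u x : 0 < t ->
  2 * bform A (S *m x) u
    <= t * bform K x x + t^-1 * bform corr (A *m u) (A *m u).
Proof.
move=> t0; have [e1 _] := correctionE u; rewrite e1.
have [sK _] := pdK; have uK := posdef_unit pdK.
have -> : bform A (S *m x) u = bform K x (z u).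
  by rewrite bform_mull /z /bform -!mulmxA (mulmxA K) mulmxV// mul1mx.
by apply: bform_young => // y; apply: bform_ge0.
Qed.

Lemma correction_sym : corr^T = corr.
Proof. by have [sK _] := pdK; rewrite !trmx_mul trmxK trmx_inv sK mulmxA. Qed.

End Correction.

End BilinearForm.

(** * Condition number from two-sided bounds *)

Section Condition.
Context {R : realType}.

(* A row eigenvector x of B A for a nonzero eigenvalue a yields the column
   eigenvector u = B x^T, for which a x^T = A u, so that a is the Rayleigh
   quotient of B at A u over that of A at u. *)
Lemma eigenvalue_bounds n (A B : 'M[R]_n) C0 C1 a :
  A^T = A -> B^T = B -> (forall x, 0 <= bform A x x) ->
  (forall u, bform A u u <= C0 * bform B (A *m u) (A *m u)) ->
  (forall u, bform B (A *m u) (A *m u) <= C1 * bform A u u) ->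
  eigenvalue (B *m A) a -> a != 0 -> 1 <= C0 * a /\ a <= C1.
Proof.
move=> sA sB pA lo up /eigenvalueP[x xBA x0] a0.
pose u := B *m x^T.
have Au : A *m u = a *: x^T.
  have : (x *m (B *m A))^T = (a *: x)^T by rewrite xBA.
  by rewrite !trmx_mul sA sB linearZ /= -mulmxA.
have Bq : bform B (A *m u) (A *m u) = a * bform A u u.
  rewrite Au bformZr bformZl (_ : bform A u u = a * bform B x^T x^T)//.
  rewrite /bform -mulmxA Au -scalemxAr mxE; congr (_ * _).
  by rewrite /u trmx_mul sB -!mulmxA.
(* If (A u, u) were 0, semidefiniteness would force A u = a x^T to vanish, while a and x are
   nonzero. *)
have uA : 0 < bform A u u.
  rewrite lt_neqAle pA andbT eq_sym; apply/eqP => uA0.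
  have Auz w : bform A u w = 0.
    have h s : 0 <= s * bform A u w *+ 2 + bform A w w.
      have := pA (s *: u + w).
      rewrite !(bformDl, bformDr, bformZl, bformZr) uA0 (bform_sym w u sA).
      by rewrite !mulr0 add0r addrA -mulr2n.
    apply/eqP; apply: contraT => nz.
    (* The value of s at which the nonnegative expression in [h] would equal -1. *)
    have := h (- (bform A w w + 1) / (2 * bform A u w)).
    rewrite (_ : _ + _ = -1); first by lra.
    by field.
  have := Auz x^T; rewrite (bform_sym _ _ sA) /bform trmxK -mulmxA Au.
  rewrite -scalemxAr mxE => /eqP; rewrite mulf_eq0 (negPf a0)/= => /eqP xx.
  case/negP: x0; apply/eqP/rowP => i; rewrite [RHS]mxE; apply/eqP.
  move: xx; rewrite mxE => /eqP; rewrite psumr_eq0; last first.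
    by move=> j _; rewrite mxE -expr2 sqr_ge0.
  by move/allP/(_ i); rewrite mem_index_enum => /(_ isT); rewrite mxE mulf_eq0 orbb.
move: (lo u) (up u); rewrite Bq => lo1 up1; split.
  by rewrite -(ler_pM2r uA) mul1r -mulrA.
by rewrite -(ler_pM2r uA).
Qed.

Lemma kappa_le n (A B : 'M[R]_n) C0 C1 :
  A^T = A -> B^T = B -> (forall x, 0 <= bform A x x) -> 0 < C0 -> 0 <= C1 ->
  (forall u, bform A u u <= C0 * bform B (A *m u) (A *m u)) ->
  (forall u, bform B (A *m u) (A *m u) <= C1 * bform A u u) ->
  kappa (B *m A) <= C1 * C0.
Proof.
move=> sA sB pA C00 C10 lo up.
have bnd := eigenvalue_bounds sA sB pA lo up.
rewrite /kappa /lambda_max /lambda_min.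
set X := [set _ | _]; set Y := [set _ | _].
(* Without nonzero eigenvalues the infimum is 0 by convention, and so is the quotient by it. *)
have [Y0|/set0P[y Yy]] := eqVneq Y set0.
  by rewrite Y0 inf0 invr0 mulr0 mulr_ge0 // ltW.
have [ey y0] := Yy.
have X1 : sup X <= C1.
  apply: ge_sup; first by exists y.
  (* The eigenvalue 0 may belong to X, and is covered by 0 <= C1. *)
  move=> a ea; have [->//|a0] := eqVneq a 0.
  by have [] := bnd _ ea a0.
have Y1 : C0^-1 <= inf Y.
  apply: lb_le_inf; first by exists y.
  move=> a [ea a0]; have [h _] := bnd _ ea a0.
  by rewrite -(ler_pM2l C00) mulfV ?gt_eqF.
have iY : 0 < inf Y by apply: lt_le_trans Y1; rewrite invr_gt0.
rewrite ler_pdivrMr// -mulrA; apply: (le_trans X1).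
rewrite ler_peMr//; rewrite -(ler_pM2l C00) mulfV ?gt_eqF// in Y1.
Qed.

End Condition.

(** * Integrals over bounded regions of space *)

Section Dot.
Context {R : realType}.
Implicit Types x y z : 'rV[R]_3.

Lemma ord3_cases (i : 'I_3) : [\/ i = 0, i = 1 | i = 2%:R].
Proof.
by case: i => -[|[|[|//]]] h; [constructor 1|constructor 2|constructor 3];
  exact/val_inj.
Qed.

Lemma sum3 (V : nmodType) (F : 'I_3 -> V) :
  \sum_i F i = F 0 + F 1 + F 2%:R.
Proof.
rewrite !big_ord_recl big_ord0 addr0 addrA.
by congr (_ + _ + _); congr (F _); apply/val_inj.
Qed.

Lemma dotvE x y : dotv x y = x 0 0 * y 0 0 + x 0 1 * y 0 1 + x 0 2%:R * y 0 2%:R.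
Proof. by rewrite /dotv sum3. Qed.

Lemma dotvC x y : dotv x y = dotv y x.
Proof. by rewrite /dotv; apply: eq_bigr => i _; rewrite mulrC. Qed.

Lemma dotvDl x y z : dotv (x + y) z = dotv x z + dotv y z.
Proof. by rewrite !dotvE !mxE; ring. Qed.

Lemma dotvDr x y z : dotv z (x + y) = dotv z x + dotv z y.
Proof. by rewrite !dotvE !mxE; ring. Qed.

Lemma dotvZl a x y : dotv (a *: x) y = a * dotv x y.
Proof. by rewrite !dotvE !mxE; ring. Qed.

Lemma dotvZr a x y : dotv x (a *: y) = a * dotv x y.
Proof. by rewrite !dotvE !mxE; ring. Qed.

Lemma dotvBl x y z : dotv (x - y) z = dotv x z - dotv y z.
Proof. by rewrite !dotvE !mxE; ring. Qed.

Lemma dotvBr x y z : dotv z (x - y) = dotv z x - dotv z y.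
Proof. by rewrite !dotvE !mxE; ring. Qed.

Lemma dotv0l x : dotv 0 x = 0.
Proof. by rewrite dotvE !mxE; ring. Qed.

Lemma dotv0r x : dotv x 0 = 0.
Proof. by rewrite dotvC dotv0l. Qed.

Lemma dotv_suml I (r : seq I) P (F : I -> 'rV[R]_3) y :
  dotv (\sum_(i <- r | P i) F i) y = \sum_(i <- r | P i) dotv (F i) y.
Proof.
by apply: (big_morph (dotv^~ y)) => [u v|]; rewrite ?dotvDl ?dotv0l.
Qed.

Lemma dotv_sumr I (r : seq I) P (F : I -> 'rV[R]_3) y :
  dotv y (\sum_(i <- r | P i) F i) = \sum_(i <- r | P i) dotv y (F i).
Proof.
by apply: (big_morph (dotv y)) => [u v|]; rewrite ?dotvDr ?dotv0r.
Qed.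

Lemma dotvv_ge0 x : 0 <= dotv x x.
Proof. by rewrite dotvE !addr_ge0// -expr2 sqr_ge0. Qed.

Lemma dotvv_eq0 x : dotv x x = 0 -> x = 0.
Proof.
rewrite /dotv => /eqP; rewrite psumr_eq0 => [|i _]; last first.
  by rewrite -expr2 sqr_ge0.
move=> /allP h; apply/rowP => i; rewrite mxE; apply/eqP.
by have := h i (mem_index_enum _); rewrite mulf_eq0 orbb.
Qed.

Lemma enorm_ge0 x : 0 <= enorm x. Proof. exact: sqrtr_ge0. Qed.

Lemma sqr_enorm x : enorm x ^+ 2 = dotv x x.
Proof. by rewrite sqr_sqrtr // dotvv_ge0. Qed.

Lemma enormN x : enorm (- x) = enorm x.
Proof. by rewrite /enorm !dotvE !mxE; congr Num.sqrt; ring. Qed.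

Lemma coord_le_enorm x i : `|x 0 i| <= enorm x.
Proof.
rewrite -(@ler_pXn2r _ 2) ?nnegrE ?enorm_ge0// sqr_enorm real_normK ?num_real//.
rewrite /dotv (bigD1 i)//= -expr2 lerDl sumr_ge0// => j _.
by rewrite -expr2 sqr_ge0.
Qed.

Lemma dotv_sqr_le x y : dotv x y ^+ 2 <= dotv x x * dotv y y.
Proof.
rewrite !dotvE -subr_ge0.
set a := x 0 0; set b := x 0 1; set c := x 0 2%:R.
set d := y 0 0; set e := y 0 1; set f := y 0 2%:R.
rewrite (_ : _ - _ = (a * e - b * d) ^+ 2 + (a * f - c * d) ^+ 2
  + (b * f - c * e) ^+ 2); last by ring.
by rewrite !addr_ge0 // sqr_ge0.
Qed.

(** Lagrange's identity: the difference of the two sides is (x . y)^2. *)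
Lemma crossv_sqr_le x y :
  dotv (crossv x y) (crossv x y) <= dotv x x * dotv y y.
Proof.
have e12 : (1 + 1 : 'I_3) = 2%:R by apply/val_inj.
have e12' : (1 + 2%:R : 'I_3) = 0 by apply/val_inj.
have e21 : (2%:R + 1 : 'I_3) = 0 by apply/val_inj.
have e22 : (2%:R + 2%:R : 'I_3) = 1 by apply/val_inj.
rewrite (dotvE (crossv x y)) !mxE !add0r e12 e12' e21 e22 -subr_ge0 !dotvE.
set a := x 0 0; set b := x 0 1; set c := x 0 2%:R.
set d := y 0 0; set e := y 0 1; set f := y 0 2%:R.
rewrite (_ : _ - _ = (a * d + b * e + c * f) ^+ 2) ?sqr_ge0//; ring.
Qed.

Lemma dotv_sum_sqr_le (I : finType) (P : pred I) (F : I -> 'rV[R]_3) :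
  dotv (\sum_(i | P i) F i) (\sum_(i | P i) F i)
    <= #|P|%:R * \sum_(i | P i) dotv (F i) (F i).
Proof.
have h i j : P i -> P j ->
    dotv (F i) (F j) <= 2^-1 * (dotv (F i) (F i) + dotv (F j) (F j)).
  move=> _ _; have := dotvv_ge0 (F i - F j).
  rewrite !(dotvBl, dotvBr) (dotvC (F j)); lra.
rewrite dotv_suml; under eq_bigr do rewrite dotv_sumr.
apply: (@le_trans _ _ (\sum_(i | P i) \sum_(j | P j)
    2^-1 * (dotv (F i) (F i) + dotv (F j) (F j)))).
  by apply: ler_sum => i Pi; apply: ler_sum => j Pj; exact: h.
set s := \sum_(i | P i) dotv _ _.
under eq_bigr do rewrite -mulr_sumr big_split /= sumr_const -/s.
rewrite -mulr_sumr big_split /= sumr_const sumrMnl -/s -mulr_natl.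
by lra.
Qed.

End Dot.

Section Integral.
Context {R : realType}.
Local Notation space :=
  (measurableTypeR R * measurableTypeR R * measurableTypeR R)%type.
Local Notation mu3 :=
  ((@lebesgue_measure R \x @lebesgue_measure R) \x @lebesgue_measure R)%E.
Implicit Types (K : set 'rV[R]_3) (f g : 'rV[R]_3 -> R).

(* Borel functions that are bounded on bounded sets. *)
Definition tame f :=
  measurable_fun [set: space] (fun p : space => f (point_of p)) /\
  forall M : R, exists N : R,
    forall x : 'rV[R]_3, (forall i, `|x 0 i| <= M) -> `|f x| <= N.

(** Tame functions are integrable over regions, so that linearity and monotonicity of [integral3]
    require no further integrability argument. *)
Definition region K :=
  measurable (((@point_of R) @^-1` K) : set space) /\
  exists M : R, forall (x : 'rV[R]_3) i, K x -> `|x 0 i| <= M.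

Definition box (a b : 'rV[R]_3) : set 'rV[R]_3 :=
  [set x | forall i, a 0 i <= x 0 i <= b 0 i].

Definition volume K := integral3 K (fun=> 1).

Lemma tame_cst c : tame (fun=> c).
Proof.
by split=> [|M]; [exact: measurable_cst|exists `|c|].
Qed.

Lemma tame_coord i : tame (fun x : 'rV[R]_3 => x 0 i).
Proof.
split=> [|M]; last by exists M.
have [->|->|->] := ord3_cases i.
- rewrite (_ : (fun _ => _) = fst \o fst); last first.
    by apply/funext => p; rewrite /= mxE.
  by apply: measurableT_comp; exact: measurable_fst.
- rewrite (_ : (fun _ => _) = snd \o fst); last first.
    by apply/funext => p; rewrite /= mxE.
  by apply: measurableT_comp; [exact: measurable_snd|exact: measurable_fst].
- rewrite (_ : (fun _ => _) = snd); last by apply/funext => p; rewrite /= mxE.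
  exact: measurable_snd.
Qed.

Lemma tameD f g : tame f -> tame g -> tame (fun x => f x + g x).
Proof.
move=> [mf bf] [mg bg]; split=> [|M]; first exact: measurable_realfun.measurable_funD.
have [N hN] := bf M; have [N' hN'] := bg M; exists (N + N') => x xM.
by rewrite (le_trans (ler_normD _ _))// lerD ?hN ?hN'.
Qed.

Lemma tameM f g : tame f -> tame g -> tame (fun x => f x * g x).
Proof.
move=> [mf bf] [mg bg]; split=> [|M]; first exact: measurable_realfun.measurable_funM.
have [N hN] := bf M; have [N' hN'] := bg M; exists (N * N') => x xM.
by rewrite normrM ler_pM ?hN ?hN'.
Qed.

Lemma tame_sum I (r : seq I) (F : I -> 'rV[R]_3 -> R) :
  (forall i, tame (F i)) -> tame (fun x => \sum_(i <- r) F i x).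
Proof.
move=> tF; elim: r => [|i r IH].
  by under eq_fun do rewrite big_nil; exact: tame_cst.
by under eq_fun do rewrite big_cons; exact: tameD.
Qed.

Definition tamev (v : 'rV[R]_3 -> 'rV[R]_3) := forall i, tame (fun x => v x 0 i).

Lemma tame_dotv u v : tamev u -> tamev v -> tame (fun x => dotv (u x) (v x)).
Proof. by move=> tu tv; apply: tame_sum => i; exact: tameM. Qed.

Lemma measure_box (a b : 'rV[R]_3) : (forall i, a 0 i <= b 0 i) ->
  region (box a b) /\
  mu3 ((@point_of R) @^-1` box a b)
  = (\prod_i (b 0 i - a 0 i))%:E.
Proof.
move=> ab; set B := box a b.
have preB : (@point_of R) @^-1` B =
    (`[a 0 0, b 0 0] `*` `[a 0 1, b 0 1]) `*` `[a 0 2%:R, b 0 2%:R].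
  apply/seteqP; split=> [p /= h|p /= [[h0 h1] h2] i].
    by move: (h 0) (h 1) (h 2%:R); rewrite !mxE /= !in_itv.
  move: h0 h1 h2; rewrite !in_itv /= => h0 h1 h2.
  by have [->|->|->] := ord3_cases i; rewrite !mxE.
have itvE i : lebesgue_measure `[a 0 i, b 0 i] = (b 0 i - a 0 i)%:E.
  rewrite lebesgue_measure_itv /= lte_fin EFinB; case: ifPn => //.
  rewrite -leNgt => ba; have -> : b 0 i = a 0 i by apply/le_anti; rewrite ba ab.
  by rewrite subee.
rewrite /region preB; split; last first.
  rewrite product_measure1E//; last exact: measurableX.
  rewrite [X in (X * _)%E](@product_measure1E _ _ _ _ R (@lebesgue_measure R)
    (@lebesgue_measure R))//.
  transitivity ((b 0 0 - a 0 0)%:E * (b 0 1 - a 0 1)%:E * (b 0 2%:R - a 0 2%:R)%:E)%E.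
    by congr (_ * _ * _)%E; exact: itvE.
  rewrite -!EFinM.
  rewrite !big_ord_recl big_ord0 mulr1 mulrA.
  by congr (_ * _ * _)%:E; congr (_ - _); congr fun_of_matrix; apply/val_inj.
split; first by apply: measurableX => //; apply: measurableX.
exists (\sum_i (`|a 0 i| + `|b 0 i|)) => x i /(_ i) /andP[ax xb].
rewrite (bigD1 i)//= -[leLHS]addr0 lerD ?sumr_ge0//.
by rewrite ler_norml; move: (ler_norm (b 0 i)) (ler_norm (- a 0 i)) ax xb;
  rewrite normrN; move: (normr_ge0 (a 0 i)) (normr_ge0 (b 0 i)); lra.
Qed.

Lemma region_fin K : region K -> (mu3 ((@point_of R) @^-1` K) < +oo)%E.
Proof.
move=> [mK [M bM]].
pose b : 'rV[R]_3 := const_mx `|M|; pose a : 'rV[R]_3 := const_mx (- `|M|).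
have ab i : a 0 i <= b 0 i by rewrite !mxE ge0_cp.
have [[mB _] eB] := measure_box ab.
have : (mu3 ((@point_of R) @^-1` K) <=
    mu3 ((@point_of R) @^-1` box a b))%E.
  apply: le_measure; rewrite ?inE// => p Kp i.
  by rewrite [a 0 i]mxE [b 0 i]mxE -ler_norml (le_trans _ (ler_norm _))// bM.
by move/le_lt_trans; apply; rewrite eB ltry.
Qed.

Section Region.
Variable (K : set 'rV[R]_3).
Hypothesis rK : region K.

Lemma tame_integrable f : tame f ->
  mu3.-integrable ((@point_of R) @^-1` K) (EFin \o (fun p => f (point_of p))).
Proof.
move=> [mf bf]; have [mK [M bM]] := rK.
apply: measurable_bounded_integrable => //.
- exact: region_fin.
- exact: measurable_funTS.
- have [N hN] := bf M; exists N; split; first exact: num_real.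
  move=> y Ny p Kp /=; apply: (le_trans _ (ltW Ny)).
  by apply: hN => i; exact: bM.
Qed.

Lemma integral3D f g : tame f -> tame g ->
  integral3 K (fun x => f x + g x) = integral3 K f + integral3 K g.
Proof.
move=> tf tg; rewrite /integral3 RintegralD//; first by have [] := rK.
- exact: tame_integrable.
- exact: tame_integrable.
Qed.

Lemma integral3Z c f : tame f ->
  integral3 K (fun x => c * f x) = c * integral3 K f.
Proof.
move=> tf; rewrite /integral3 RintegralZl//; first by have [] := rK.
exact: tame_integrable.
Qed.

Lemma integral3_cst c : integral3 K (fun=> c) = c * volume K.
Proof.
rewrite /volume -integral3Z; last exact: tame_cst.
by congr integral3; apply/funext => x; rewrite mulr1.
Qed.

Lemma le_integral3 f g : tame f -> tame g ->
  (forall x, K x -> f x <= g x) -> integral3 K f <= integral3 K g.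
Proof.
move=> tf tg fg; apply: le_Rintegral.
- by have [] := rK.
- exact: tame_integrable.
- exact: tame_integrable.
- by move=> p Kp; exact: fg.
Qed.

Lemma integral3_ge0 f : (forall x, K x -> 0 <= f x) -> 0 <= integral3 K f.
Proof. by move=> f0; apply: Rintegral_ge0 => p Kp; exact: f0. Qed.

Lemma volume_ge0 : 0 <= volume K.
Proof. by apply: integral3_ge0 => x _; exact: ler01. Qed.

Lemma le_integral3_subset L f : region L -> tame f -> L `<=` K ->
  (forall x, K x -> 0 <= f x) -> integral3 L f <= integral3 K f.
Proof.
move=> rL tf LK f0; have [mK _] := rK; have [mL _] := rL.
rewrite /integral3 /Rintegral fine_le//.
- apply: integrable_fin_num => //; apply: integrableS (tame_integrable tf) => //.
  by move=> p Lp; exact: LK.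
- by apply: integrable_fin_num => //; exact: tame_integrable.
- apply: ge0_subset_integral => //; last by move=> p Lp; exact: LK.
    by apply/measurable_realfun.measurable_EFinP; apply: measurable_funTS; case: tf.
  by move=> p Kp; rewrite lee_fin f0.
Qed.

End Region.

Lemma volume_box (a b : 'rV[R]_3) : (forall i, a 0 i <= b 0 i) ->
  volume (box a b) = \prod_i (b 0 i - a 0 i).
Proof.
move=> ab; have [[mB _] eB] := measure_box ab.
rewrite /volume /integral3 Rintegral_cst// mul1r.
by rewrite -[RHS]/(fine (_%:E)) -eB.
Qed.

Lemma volume_le_cube K (c : 'rV[R]_3) h : region K -> 0 <= h ->
  (forall (x : 'rV[R]_3) i, K x -> `|x 0 i - c 0 i| <= h) -> volume K <= 8 * h ^+ 3.
Proof.
move=> rK h0 Kh.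
pose a : 'rV[R]_3 := \row_i (c 0 i - h); pose b : 'rV[R]_3 := \row_i (c 0 i + h).
have ab i : a 0 i <= b 0 i by rewrite !mxE; lra.
have [rB _] := measure_box ab.
have -> : 8 * h ^+ 3 = \prod_i (b 0 i - a 0 i).
  by rewrite !big_ord_recl big_ord0 !mxE; ring.
rewrite -volume_box//; apply: le_integral3_subset => //; first exact: tame_cst.
by move=> x Kx i; have := Kh x i Kx; rewrite !mxE ler_norml; lra.
Qed.

Definition affine f := exists (a : R) (b : 'rV[R]_3), forall x, f x = a + dotv b x.

Lemma tame_affine f : affine f -> tame f.
Proof.
move=> [a [b h]]; rewrite (_ : f = fun x => a + dotv b x); last exact/funext.
apply: tameD; first exact: tame_cst.
by apply: tame_dotv => i; [exact: tame_cst|exact: tame_coord].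
Qed.

(* On the corner of side s/2 of the cube where the linear part has the sign of
   f c, |f| is at least |f c| + (s/2) (|b_0| + |b_1| + |b_2|). *)
Lemma integral3_affine_sqr K f (a : R) (b c : 'rV[R]_3) s : region K -> 0 < s ->
  (forall x, f x = a + dotv b x) ->
  (forall x : 'rV[R]_3, (forall i, `|x 0 i - c 0 i| <= s) -> K x) ->
  (s / 2) ^+ 3 * (`|f c| + s / 2 * \sum_i `|b 0 i|) ^+ 2
    <= integral3 K (fun x => f x * f x).
Proof.
move=> rK s0 fE cK.
pose up i := (0 <= f c) == (0 <= b 0 i).
pose l : 'rV[R]_3 := \row_i (c 0 i + (if up i then s / 2 else - s)).
pose u : 'rV[R]_3 := \row_i (c 0 i + (if up i then s else - (s / 2))).
have lu i : l 0 i <= u 0 i by rewrite !mxE; case: ifP => _; lra.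
have [rB _] := measure_box lu.
set B := box l u in rB.
have tf : tame (fun x => f x * f x).
  by apply: tameM; apply: tame_affine; exists a, b.
have BK : B `<=` K.
  move=> x Bx; apply: cK => i; have := Bx i; rewrite !mxE ler_norml.
  by case: ifP => _; lra.
apply: le_trans (le_integral3_subset rK rB tf BK _); last first.
  by move=> x _; rewrite -expr2 sqr_ge0.
have -> : (s / 2) ^+ 3 = volume B.
  rewrite /B volume_box// (eq_bigr (fun=> s / 2)).
    by rewrite prodr_const card_ord.
  by move=> i _; rewrite !mxE; case: ifP => _; lra.
rewrite mulrC -integral3_cst//; apply: le_integral3 => //; first exact: tame_cst.
move=> x Bx; rewrite -expr2 -[f x ^+ 2]real_normK ?num_real//.
have s0W := ltW s0.
rewrite ler_pXn2r ?nnegrE ?addr_ge0 ?mulr_ge0 ?sumr_ge0//.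
have -> : f x = f c + \sum_i b 0 i * (x 0 i - c 0 i).
  by rewrite !fE !dotvE sum3; ring.
have [fc0|fc0] := leP 0 (f c).
  apply: (le_trans _ (ler_norm _)); rewrite ger0_norm// lerD2l mulr_sumr.
  apply: ler_sum => i _; have := Bx i; rewrite !mxE /up fc0.
  case: (leP 0 (b 0 i)) => /= bi /andP[h1 h2].
    by rewrite ger0_norm// mulrC ler_wpM2l//; lra.
  rewrite ltr0_norm// mulrN -mulNr mulrC; apply: ler_wnM2l; [exact: ltW|lra].
rewrite -[leRHS]normrN; apply: (le_trans _ (ler_norm _)).
rewrite ltr0_norm// opprD lerD2l mulr_sumr -sumrN.
apply: ler_sum => i _; have := Bx i; rewrite !mxE /up [0 <= f c]leNgt fc0 /=.
case: (leP 0 (b 0 i)) => /= bi /andP[h1 h2].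
  by rewrite ger0_norm// mulrC -mulrN ler_wpM2l//; lra.
rewrite ltr0_norm//.
by nra.
Qed.

End Integral.

(** * Affine fields *)

Section Affine.
Context {R : realType}.
Implicit Types (f g : 'rV[R]_3 -> R) (x y z : 'rV[R]_3).

Lemma gradf_affine f (a : R) (b : 'rV[R]_3) x :
  (forall y, f y = a + dotv b y) -> gradf f x = b.
Proof.
move=> fE; apply/rowP => i; rewrite mxE /partial /derive.
apply: cvg_lim; first exact: Rhausdorff.
apply: cvg_near_cst; near=> h.
have h0 : h != 0 by near: h; exact: nbhs_dnbhs_neq.
rewrite /= !fE dotvDr dotvZr (_ : dotv b (delta_mx 0 i) = b 0 i); last first.
  rewrite /dotv (bigD1 i)//= mxE !eqxx mulr1 big1 ?addr0// => j ji.
  by rewrite mxE (negPf ji) andbF mulr0.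
by rewrite /GRing.scale /=; field.
Unshelve. all: by end_near. Qed.

Lemma affine_diff f x y z : affine f -> f x - f y = dotv (gradf f z) (x - y).
Proof.
by move=> [a [b fE]]; rewrite (gradf_affine _ fE) !fE dotvBr; ring.
Qed.

Lemma gradf_cst f x y : affine f -> gradf f x = gradf f y.
Proof. by move=> [a [b fE]]; rewrite !(gradf_affine _ fE). Qed.

Lemma affineE f x : affine f -> f x = f 0 + dotv (gradf f 0) x.
Proof. by move=> [a [b fE]]; rewrite (gradf_affine _ fE) !fE dotv0r; ring. Qed.

Lemma affine_const (c : R) : affine (fun=> c).
Proof. by exists c, 0 => x; rewrite dotv0l addr0. Qed.

Lemma affine_lincomb I (r : seq I) P (c : I -> R) (F : I -> 'rV[R]_3 -> R) :
  (forall i, affine (F i)) ->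
  affine (fun x => \sum_(i <- r | P i) c i * F i x) /\
  forall x, gradf (fun x => \sum_(i <- r | P i) c i * F i x) x
    = \sum_(i <- r | P i) c i *: gradf (F i) x.
Proof.
move=> aF.
have E x : \sum_(i <- r | P i) c i * F i x = \sum_(i <- r | P i) c i * F i 0
    + dotv (\sum_(i <- r | P i) c i *: gradf (F i) 0) x.
  rewrite dotv_suml -big_split /=; apply: eq_bigr => i _.
  by rewrite dotvZl -mulrDr -affineE.
split; first by do 2 eexists; exact: E.
move=> x; rewrite (gradf_affine _ E); apply: eq_bigr => i _.
by rewrite (gradf_cst 0 x).
Qed.

Lemma affineD2 (a b : R) f g : affine f -> affine g ->
  affine (fun x => a * f x + b * g x) /\
  forall x, gradf (fun x => a * f x + b * g x) x
    = a *: gradf f x + b *: gradf g x.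
Proof.
move=> af ag; have E x : a * f x + b * g x =
    (a * f 0 + b * g 0) + dotv (a *: gradf f 0 + b *: gradf g 0) x.
  by rewrite dotvDl !dotvZl (affineE x af) (affineE x ag); ring.
split; first by do 2 eexists; exact: E.
by move=> x; rewrite (gradf_affine _ E) (gradf_cst x 0 af) (gradf_cst x 0 ag).
Qed.

Lemma affine_comb f (I : finType) (c : I -> R) (p : I -> 'rV[R]_3) :
  affine f -> \sum_i c i = 1 -> f (\sum_i c i *: p i) = \sum_i c i * f (p i).
Proof.
move=> [a [b fE]] c1; rewrite fE dotv_sumr -[a]mul1r -c1 mulr_suml -big_split /=.
by apply: eq_bigr => i _; rewrite fE dotvZr mulrDr.
Qed.

Definition affinev (v : 'rV[R]_3 -> 'rV[R]_3) :=
  forall i, affine (fun x => v x 0 i).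

Lemma tame_affinev v : affinev v -> tamev v.
Proof. by move=> av i; exact: tame_affine. Qed.

Lemma curlfE (v : 'rV[R]_3 -> 'rV[R]_3) x i :
  curlf v x 0 i = gradf (fun y => v y 0 (i + 2%:R)) x 0 (i + 1)
    - gradf (fun y => v y 0 (i + 1)) x 0 (i + 2%:R).
Proof. by rewrite !mxE. Qed.

Lemma curlf_cst v x y : affinev v -> curlf v x = curlf v y.
Proof.
by move=> av; apply/rowP => i; rewrite !curlfE !(gradf_cst x y (av _)).
Qed.

Lemma affinev_lincomb I (r : seq I) P (c : I -> R)
    (F : I -> 'rV[R]_3 -> 'rV[R]_3) : (forall i, affinev (F i)) ->
  affinev (fun x => \sum_(i <- r | P i) c i *: F i x) /\
  forall x, curlf (fun x => \sum_(i <- r | P i) c i *: F i x) x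
    = \sum_(i <- r | P i) c i *: curlf (F i) x.
Proof.
move=> aF.
have E k : (fun x => (\sum_(i <- r | P i) c i *: F i x) 0 k) =
    (fun x => \sum_(i <- r | P i) c i * (F i x 0 k)).
  by apply/funext => x; rewrite summxE; apply: eq_bigr => i _; rewrite mxE.
have L k := affine_lincomb r P c (fun i => aF i k).
split=> [k|x]; first by rewrite E; case: (L k).
apply/rowP => k; rewrite curlfE !E (L _).2 (L _).2 !summxE -sumrB.
by apply: eq_bigr => i _; rewrite !mxE mulrBr.
Qed.

(* The Whitney form of the pair (f, g). *)
Definition wform f g : 'rV[R]_3 -> 'rV[R]_3 :=
  fun x => f x *: gradf g x - g x *: gradf f x.

Lemma wformE f g k : affine f -> affine g -> (fun x => wform f g x 0 k) =
  (fun x => gradf g 0 0 k * f x + (- gradf f 0 0 k) * g x).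
Proof.
move=> af ag; apply/funext => x; rewrite /wform mxE [in X in _ + X]mxE.
rewrite [X in X - _]mxE [X in _ - X]mxE (gradf_cst x 0 af) (gradf_cst x 0 ag).
by ring.
Qed.

Lemma affinev_wform f g : affine f -> affine g -> affinev (wform f g).
Proof. by move=> af ag k; rewrite wformE//; case: (affineD2 (gradf g 0 0 k)
  (- gradf f 0 0 k) af ag). Qed.

Lemma curlf_wform f g x : affine f -> affine g ->
  curlf (wform f g) x = 2 *: crossv (gradf f x) (gradf g x).
Proof.
move=> af ag; apply/rowP => i; rewrite curlfE !wformE//.
rewrite (affineD2 _ _ af ag).2 (affineD2 _ _ af ag).2.
rewrite (gradf_cst 0 x af) (gradf_cst 0 x ag).
by move: (gradf f x) (gradf g x) => p q; rewrite !mxE; ring.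
Qed.

Lemma wform_dotv f g x y z : affine f -> affine g ->
  dotv (wform f g x) (y - z) = f x * (g y - g z) - g x * (f y - f z).
Proof.
move=> af ag.
by rewrite dotvBl !dotvZl -(affine_diff y z x af) -(affine_diff y z x ag).
Qed.

Lemma crossv_rotation (v : 'rV[R]_3 -> 'rV[R]_3) (a b : 'rV[R]_3) :
  (forall x, v x = a + crossv b x) -> affinev v.
Proof.
move=> vE i.
exists (a 0 i), (\row_j (b 0 (i + 1) * (j == i + 2%:R)%:R
  - b 0 (i + 2%:R) * (j == i + 1)%:R)) => x.
rewrite vE !mxE /dotv; congr (_ + _).
under eq_bigr do rewrite mxE mulrBl.
rewrite sumrB (bigD1 (i + 2%:R))//= [in X in _ = _ - X](bigD1 (i + 1))//=.
rewrite !eqxx !big1 ?addr0 ?mulr1// => j /negPf->; by rewrite mulr0 mul0r.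
Qed.

(* (a . x) b - (b . x) a = (a x b) x x *)
Lemma wform_rotation f g : affine f -> affine g ->
  exists a b : 'rV[R]_3, forall x, wform f g x = a + crossv b x.
Proof.
move=> af ag.
exists (f 0 *: gradf g 0 - g 0 *: gradf f 0), (crossv (gradf f 0) (gradf g 0)).
move=> x; rewrite /wform (affineE x af) (affineE x ag).
rewrite (gradf_cst x 0 af) (gradf_cst x 0 ag).
move: (gradf f 0) (gradf g 0) => p q.
have e12 : (1 + 1 : 'I_3) = 2%:R by apply/val_inj.
have e12' : (1 + 2%:R : 'I_3) = 0 by apply/val_inj.
have e21 : (2%:R + 1 : 'I_3) = 0 by apply/val_inj.
have e22 : (2%:R + 2%:R : 'I_3) = 1 by apply/val_inj.
apply/rowP => i; rewrite !mxE !dotvE.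
by have [->|->|->] := ord3_cases i;
  rewrite !(add0r, e12, e12', e21, e22); ring.
Qed.

Lemma affinev_lincomb_rotation I (r : seq I) (c : I -> R)
    (F : I -> 'rV[R]_3 -> 'rV[R]_3) :
  (forall i, exists a b, forall x, F i x = a + crossv b x) ->
  exists a b : 'rV[R]_3, forall x, \sum_(i <- r) c i *: F i x = a + crossv b x.
Proof.
move=> rF; elim: r => [|i r [a [b IH]]].
  exists 0, 0 => x; rewrite big_nil add0r; apply/rowP => j; rewrite !mxE; ring.
have [a' [b' FE]] := rF i; exists (c i *: a' + a), (c i *: b' + b) => x.
by rewrite big_cons IH FE; apply/rowP => j; rewrite !mxE; ring.
Qed.

End Affine.

(** * Barycentric coordinates *)

Section Tetrahedron.
Context {R : realType}.
Variables (M : mesh R) (t : 'I_(ntet M)).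
Local Notation V := 'I_(nvert M).
Local Notation vt := (@vert R M).
Hypothesis tet_inj : injective (tet t).
Hypothesis tet_free : affinely_independent vt (tverts t).

(** Passage between the global numbering of vertices, in which [lam] is indexed, and the four local
    indices of [bary]. *)
Lemma sum_fiber (W : lmodType R) (c : 'I_4 -> R) (F : V -> W) :
  \sum_i (\sum_(k | tet t k == i) c k) *: F i = \sum_k c k *: F (tet t k).
Proof.
rewrite (partition_big (tet t) xpredT)//=; apply: eq_bigr => i _.
by rewrite scaler_suml; apply: eq_bigr => k /eqP <-.
Qed.

Lemma mem_tverts k : tet t k \in tverts t.
Proof. exact: imset_f. Qed.

Lemma fiber_notin (c : 'I_4 -> R) i : i \notin tverts t ->
  \sum_(k | tet t k == i) c k = 0.
Proof.
by move=> it; rewrite big1// => k /eqP ki; rewrite -ki mem_tverts in it.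
Qed.

Lemma fiber_in (c : 'I_4 -> R) k : \sum_(l | tet t l == tet t k) c l = c k.
Proof. by rewrite (big_pred1 k)// => l; rewrite (inj_eq tet_inj). Qed.

Let P : 'M[R]_4 := \matrix_(l < 4) row_mx 1 (vt (tet t l)).

Lemma sum_row_mx (c : 'I_4 -> R) :
  \sum_k c k *: (row_mx 1 (vt (tet t k)) : 'rV[R]_(1 + 3)) =
  row_mx (\sum_k c k)%:M (\sum_k c k *: vt (tet t k)).
Proof.
elim/big_ind3 : _ => [|x1 x2 x3 y1 y2 y3|k _].
- by rewrite raddf0 row_mx0.
- by move=> -> ->; rewrite add_row_mx raddfD.
- by rewrite scale_row_mx scalemx1.
Qed.

(** A row vector killed by P has entries of sum zero and annihilates the vertices, so it is an
    affine dependence between the vertices of t. *)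
Lemma bary_unit : P \in unitmx.
Proof.
rewrite -row_free_unit -kermx_eq0; apply/eqP/row_matrixP => i.
rewrite row0; set v := row i _.
have : v *m P = 0 by apply/sub_kermxP; rewrite row_sub.
rewrite mulmx_sum_row; under eq_bigr do rewrite rowK.
rewrite sum_row_mx -[0 in RHS](@row_mx0 _ 1 1 3).
move=> /(@eq_row_mx _ 1 1 3)[v1 v2].
have vz := tet_free (fiber_notin (v 0)).
apply/rowP => k; rewrite [RHS]mxE -(fiber_in (v 0)).
apply: vz; last by rewrite sum_fiber.
rewrite -[LHS](mulr1) mulr_suml.
have := sum_fiber (v 0) (fun=> 1 : R^o); rewrite /GRing.scale /= => ->.
by have /matrixP/(_ 0 0) := v1; rewrite !mxE mulr1n; under eq_bigr do rewrite mulr1.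
Qed.

Lemma bary_row x : row_mx (\sum_k bary t k x)%:M (\sum_k bary t k x *: vt (tet t k))
  = row_mx 1 x.
Proof.
rewrite -sum_row_mx; have := mulmxKV bary_unit (row_mx 1 x).
rewrite [X in X = _ -> _]mulmx_sum_row => e; rewrite -[RHS]e; apply: eq_bigr => k _.
by rewrite rowK.
Qed.

Lemma lam_sum1 x : \sum_i lam i t x = 1.
Proof.
have /(@eq_row_mx _ 1 1 3)[/matrixP/(_ 0 0)] := bary_row x.
rewrite !mxE eqxx mulr1n => h _; transitivity (\sum_k bary t k x); last exact: h.
have := sum_fiber (bary t ^~ x) (fun=> 1 : R^o); rewrite /GRing.scale /=.
by under eq_bigr do rewrite mulr1; under [in RHS]eq_bigr do rewrite mulr1.
Qed.

Lemma lam_sumE x : \sum_i lam i t x *: vt i = x.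
Proof. by have /(@eq_row_mx _ 1 1 3)[_] := bary_row x; rewrite -sum_fiber. Qed.

Lemma affine_bary k : affine (bary t k).
Proof.
set Q := invmx P.
exists (Q (@lshift 1 3 0) k), (\row_j Q (@rshift 1 3 j) k) => x.
rewrite /bary mxE (@big_split_ord _ _ _ 1 3) /= big_ord1 -/P -/Q (@row_mxEl _ 1 1 3) mxE eqxx mul1r.
by congr (_ + _); apply: eq_bigr => j _; rewrite (@row_mxEr _ 1 1 3) mxE mulrC.
Qed.

Lemma affine_lam i : affine (lam i t).
Proof.
have [h _] := affine_lincomb (index_enum 'I_4) (fun k => tet t k == i)
  (fun=> 1) affine_bary.
rewrite (_ : lam i t = fun x => \sum_(k | tet t k == i) 1 * bary t k x) //.
by apply/funext => x; apply: eq_bigr => k _; rewrite mul1r.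
Qed.

Lemma lam_notin i x : i \notin tverts t -> lam i t x = 0.
Proof. exact: fiber_notin. Qed.

Lemma lam_vert i j : j \in tverts t -> lam i t (vt j) = (i == j)%:R.
Proof.
move=> /imsetP[l _ ->]; have [it|it] := boolP (i \in tverts t); last first.
  rewrite lam_notin//; case: eqP => // il.
  by rewrite il mem_tverts in it.
have /imsetP[k _ ->] := it; rewrite /lam fiber_in (inj_eq tet_inj).
rewrite /bary (_ : row_mx 1 (vt (tet t l)) = row l P); last by rewrite rowK.
by rewrite -row_mul mulmxV ?bary_unit// !mxE eq_sym.
Qed.

(** Uniqueness of barycentric coordinates: an affine function commutes with affine combinations, and
    [lam i] is the indicator of i on the vertices of t. *)
Lemma lam_comb (c : V -> R) i : (forall j, j \notin tverts t -> c j = 0) ->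
  \sum_j c j = 1 -> lam i t (\sum_j c j *: vt j) = c i.
Proof.
move=> ct c1; rewrite affine_comb//; last exact: affine_lam.
rewrite (bigD1 i)//= big1 => [|j ji]; rewrite ?addr0.
  have [it|it] := boolP (i \in tverts t); last by rewrite ct// mul0r.
  by rewrite lam_vert// eqxx mulr1.
have [jt|jt] := boolP (j \in tverts t); last by rewrite ct// mul0r.
by rewrite lam_vert// eq_sym (negPf ji) mulr0.
Qed.

Lemma sum_lam_affine f x : affine f -> f x = \sum_i f (vt i) * lam i t x.
Proof.
move=> af; rewrite -{1}(lam_sumE x) affine_comb ?lam_sum1//.
by apply: eq_bigr => i _; rewrite mulrC.
Qed.

Lemma simplexP (F : {set V}) x : F \subset tverts t ->
  simplex F x <-> forall i, 0 <= lam i t x /\ (i \notin F -> lam i t x = 0).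
Proof.
move=> Ft; split=> [[c [c0 cF c1 xE]] i|h].
  have e : lam i t x = c i.
    rewrite xE lam_comb// => j jt; apply: cF.
    by apply: contra jt => /(fintype.subsetP Ft).
  by rewrite e; split; [exact: c0|exact: cF].
exists (fun i => lam i t x); split.
- by move=> i; have [] := h i.
- by move=> i; have [_] := h i.
- exact: lam_sum1.
- by rewrite lam_sumE.
Qed.

Lemma eltP x : elt t x <-> forall i, 0 <= lam i t x.
Proof.
split=> [/simplexP h i|h]; first by have [] := h (subxx _) i.
by apply/simplexP => // i; split=> [|/lam_notin].
Qed.

Lemma lam_le1 i x : elt t x -> lam i t x <= 1.
Proof.
move=> /eltP h; rewrite -(lam_sum1 x) (bigD1 i)//= lerDl.
by apply: sumr_ge0 => j _.
Qed.

Lemma elt_vert i : i \in tverts t -> elt t (vt i).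
Proof. by move=> it; apply/eltP => j; rewrite lam_vert. Qed.

Lemma simplex_convex (F : {set V}) x y s : simplex F x -> simplex F y ->
  0 <= s <= 1 -> simplex F (x + s *: (y - x)).
Proof.
move=> [c [c0 cF c1 ->]] [d [d0 dF d1 ->]] /andP[s0 s1].
exists (fun i => c i + s * (d i - c i)); split.
- move=> i; have := c0 i; have := d0 i; nra.
- by move=> i iF; rewrite cF// dF// subrr mulr0 addr0.
- by rewrite big_split /= -mulr_sumr sumrB c1 d1 subrr mulr0 addr0.
- rewrite -sumrB scaler_sumr -big_split /=; apply: eq_bigr => i _.
  by rewrite -scalerBl scalerA -scalerDl.
Qed.

(** A tetrahedron is a finite intersection of half-spaces [0 <= lam i], and its points are convex
    combinations of vertices. *)
Lemma region_elt : region (elt t).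
Proof.
split.
  rewrite (_ : _ @^-1` _ = \bigcap_(i in [set: V])
    [set p | 0 <= lam i t (point_of p)]); last first.
    by apply/seteqP; split=> [p /eltP h i _|p h]; [exact: h|apply/eltP => i; exact: h].
  apply: fin_bigcap_measurable; first exact: finite_finset.
  move=> i _; have [m _] := tame_affine (affine_lam i).
  have := m measurableT _ (measurable_itv `[0%R, +oo[); rewrite setTI.
  congr measurable; apply/seteqP.
  by split=> p /=; rewrite in_itv /= andbT.
exists (\sum_i \sum_j `|vt i 0 j|) => x j /[dup] xt /eltP h.
rewrite -{1}(lam_sumE x) summxE; apply: (le_trans (ler_norm_sum _ _ _)).
apply: ler_sum => i _; rewrite mxE normrM ger0_norm//.
apply: (@le_trans _ _ `|vt i 0 j|); first by rewrite ler_piMl// lam_le1.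
by rewrite (bigD1 j)//= lerDl sumr_ge0.
Qed.

Lemma sum_gradf_lam x : \sum_i gradf (lam i t) x = 0.
Proof.
have [_ h] := affine_lincomb (index_enum V) predT (fun=> 1) affine_lam.
have := h x; under [X in _ = X -> _]eq_bigr do rewrite scale1r.
move=> <-; apply: (@gradf_affine _ _ 1) => y; rewrite dotv0l addr0.
by rewrite -[RHS](lam_sum1 y); apply: eq_bigr => i _; rewrite mul1r.
Qed.

Lemma gradf_lam_notin i x : i \notin tverts t -> gradf (lam i t) x = 0.
Proof.
move=> it; apply: (@gradf_affine _ _ 0) => y.
by rewrite dotv0l addr0 lam_notin.
Qed.

Lemma gradf_sum_lam f x : affine f ->
  gradf f x = \sum_i f (vt i) *: gradf (lam i t) x.
Proof.
move=> af.
have [_ h] := affine_lincomb (index_enum V) predT (fun i => f (vt i)) affine_lam.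
by rewrite -h; congr gradf; apply/funext => y; exact: sum_lam_affine.
Qed.

(** Take a third vertex k of t and test with z = v_i - v_k, w = v_j - v_k. For the two gradients a,
    b one has (a . z)(b . w) - (b . z)(a . w) = 1, and the left-hand side equals ((a x b) x z) . w.
    Hence a Whitney function has a nonzero curl. *)
Lemma crossv_gradf_lam_neq0 i j x : i \in tverts t -> j \in tverts t -> i != j ->
  crossv (gradf (lam i t) x) (gradf (lam j t) x) != 0.
Proof.
move=> it jt ij; apply/negP => /eqP ab0.
have [k kt /andP[ki kj]] : exists2 k, k \in tverts t & (k != i) && (k != j).
  have : (0 < #|tverts t :\: [set i; j]|)%N.
    rewrite cardsD subn_gt0 card_imset// card_ord.
    apply: (leq_ltn_trans (subset_leq_card (finset.subsetIr _ _))).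
    by rewrite cards2 ij.
  by move=> /card_gt0P[k]; rewrite !inE negb_or => /andP[? ?]; exists k.
have dl m : dotv (gradf (lam m t) x) (vt i - vt k) = (m == i)%:R - (m == k)%:R.
  by rewrite -(affine_diff _ _ x (affine_lam m)) !lam_vert.
have dl' m : dotv (gradf (lam m t) x) (vt j - vt k) = (m == j)%:R - (m == k)%:R.
  by rewrite -(affine_diff _ _ x (affine_lam m)) !lam_vert.
set a := gradf (lam i t) x in ab0; set b := gradf (lam j t) x in ab0.
have tri (z w : 'rV[R]_3) : dotv a z * dotv b w - dotv b z * dotv a w =
    dotv (crossv (crossv a b) z) w.
  have e12 : (1 + 1 : 'I_3) = 2%:R by apply/val_inj.
  have e12' : (1 + 2%:R : 'I_3) = 0 by apply/val_inj.
  have e21 : (2%:R + 1 : 'I_3) = 0 by apply/val_inj.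
  have e22 : (2%:R + 2%:R : 'I_3) = 1 by apply/val_inj.
  clear -e12 e12' e21 e22; move: a b => a b; rewrite !dotvE !mxE.
  by rewrite !(add0r, e12, e12', e21, e22); ring.
have := tri (vt i - vt k) (vt j - vt k).
rewrite !dl !dl' !eqxx ab0 (eq_sym j i) !(eq_sym _ k) (negPf ki) (negPf kj) (negPf ij).
rewrite (_ : crossv 0 _ = 0) ?dotv0l; first by rewrite /=; lra.
by apply/rowP => m; rewrite !mxE; ring.
Qed.

End Tetrahedron.

(** * Finite element fields and degrees of freedom *)

Section Mesh.
Context {R : realType}.
Variables (Om : set 'rV[R]_3) (M : mesh R).
Local Notation V := 'I_(nvert M).
Local Notation T := 'I_(ntet M).
Local Notation vt := (@vert R M).
Local Notation ivert := (ivert Om M).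
Local Notation iedge := (iedge Om M).
Hypothesis opOm : open Om.
Hypothesis triM : triangulates Om M.

Lemma tet_injP t : injective (@tet R M t).
Proof. by have [_ [h _] _ _ _] := triM; have [] := h t. Qed.

Lemma tet_freeP t : affinely_independent vt (tverts t).
Proof. by have [_ [h _] _ _ _] := triM; have [] := h t. Qed.

Let tinj := tet_injP.
Let tfree := tet_freeP.

(** A common point lies in the simplex of the common vertices, and its weights there are its
    barycentric coordinates in both tetrahedra. *)
Lemma lam_glue (t t' : T) (i : V) (x : 'rV[R]_3) : elt t x -> elt t' x -> lam i t x = lam i t' x.
Proof.
move=> tx t'x; have [_ _ h _ _] := triM.
have : (elt t `&` elt t') x by [].
rewrite h => -[c [c0 cF c1 ->]].
rewrite !lam_comb// => j jt; apply: cF; rewrite inE negb_and jt ?orbT//.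
Qed.

Lemma simplex_sub (F G : {set V}) : F \subset G -> @simplex R M F `<=` simplex G.
Proof.
move=> FG x [c [c0 cF c1 ->]]; exists c; split=> // i iG.
by apply: cF; apply: contra iG => /(fintype.subsetP FG).
Qed.

Lemma bdry_notin (x : 'rV[R]_3) : bdry Om x -> ~ Om x.
Proof. by move=> [_ h] ox; apply: h; have /interior_id -> := opOm. Qed.

Lemma vert_simplex (F : {set V}) (i : V) : i \in F -> simplex F (vt i).
Proof.
move=> iF; exists (fun j => (j == i)%:R); split.
- by move=> j; rewrite ler0n.
- by move=> j jF; case: eqP => // ji; rewrite ji iF in jF.
- by rewrite (bigD1 i)//= eqxx big1 ?addr0// => j /negPf->.
- by rewrite (bigD1 i)//= eqxx scale1r big1 ?addr0// => j /negPf->; rewrite scale0r.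
Qed.

(* The boundary is a union of boundary faces, on which the barycentric
   coordinate of an interior vertex vanishes. *)
Lemma lam_bdry (t : T) (i : V) (x : 'rV[R]_3) : Om (vt i) -> elt t x -> bdry Om x -> lam i t x = 0.
Proof.
move=> oi tx; have [_ _ _ _ ->] := triM => -[F [_ [t' Ft'] Fb] Fx].
have t'x : elt t' x by apply: simplex_sub Fx.
rewrite (lam_glue i tx t'x).
have /(simplexP (@tinj t') (@tfree t') x Ft') h := Fx.
have [_] := h i; apply; apply/negP => iF.
by have := bdry_notin (Fb _ (vert_simplex iF)).
Qed.

Definition pfield (c : ivert -> R) : sfield M :=
  fun t x => \sum_i c i * hat i t x.

Definition p3field (c : ivert * 'I_3 -> R) : vfield M :=
  fun t x => \sum_i c i *: hat3 i t x.

Definition efield (u : iedge -> R) : vfield M :=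
  fun t x => \sum_e u e *: whitney e t x.

Lemma affine_pfield c t : affine (pfield c t).
Proof.
have [h _] := affine_lincomb (index_enum ivert) predT c
  (fun i => affine_lam t (val i)).
exact: h.
Qed.

Lemma affinev_hat3 ik t : affinev (@hat3 R Om M ik t).
Proof.
move=> k; have [|h _] := @affineD2 _ ((delta_mx 0 ik.2 : 'rV[R]_3) 0 k) 0
  (hat ik.1 t) (fun=> 0) _ (affine_const 0).
  exact: affine_lam.
rewrite (_ : (fun x => _) = (fun x => (delta_mx 0 ik.2 : 'rV[R]_3) 0 k *
  hat ik.1 t x + 0 * 0))//.
by apply/funext => x; rewrite mxE mulrC mulr0 addr0.
Qed.

Lemma affinev_p3field c t : affinev (p3field c t).
Proof.
by have [] := affinev_lincomb (index_enum (ivert * 'I_3)%type) predT c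
  (fun ik => @affinev_hat3 ik t).
Qed.

Lemma whitneyE e t : @whitney R Om M e t = wform (lam (val e).1 t) (lam (val e).2 t).
Proof. by []. Qed.

Lemma affinev_whitney e t : affinev (@whitney R Om M e t).
Proof. by rewrite whitneyE; apply: affinev_wform; exact: affine_lam. Qed.

Lemma affinev_efield u t : affinev (efield u t).
Proof.
by have [] := affinev_lincomb (index_enum iedge) predT u
  (fun e => @affinev_whitney e t).
Qed.

Lemma affinev_Hcurl (v : vfield M) : Hcurl Om v -> forall t, affinev (v t).
Proof. by move=> [h _ _] t; have [a [b vE]] := h t; exact: crossv_rotation vE. Qed.

Lemma affinev_Hgrad3 (v : vfield M) : Hgrad3 Om v -> forall t, affinev (v t).
Proof. by move=> h t k; have [af _ _] := h k; exact: af t. Qed.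

Lemma affinev_grad (u : sfield M) t : affine (u t) -> affinev (@grad R M u t).
Proof.
move=> au k; exists (gradf (u t) 0 0 k), 0 => x.
by rewrite dotv0l addr0 /grad (gradf_cst x 0 au).
Qed.

Lemma Hgrad_pfield c : Hgrad Om (pfield c).
Proof.
split=> [t|t t' x tx t'x|t x tx bx]; first exact: affine_pfield.
  by rewrite /pfield; apply: eq_bigr => i _; rewrite /hat (lam_glue _ tx t'x).
rewrite /pfield big1// => i _; rewrite /hat lam_bdry ?mulr0//.
by have := valP i; rewrite /= in_setE.
Qed.

Lemma comp_p3field c k : Defs.comp k (p3field c) = pfield (fun i => c (i, k)).
Proof.
apply/funext => t; apply/funext => x; rewrite /Defs.comp /p3field /pfield summxE.
rewrite (eq_bigr (fun p => (c (p.1, p.2) *: hat3 (p.1, p.2) t x) 0 k)); last first.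
  by case.
rewrite -(pair_bigA _ (fun i l => (c (i, l) *: hat3 (i, l) t x) 0 k)) /=.
apply: eq_bigr => i _; rewrite (bigD1 k)//= !mxE !eqxx mulr1.
rewrite big1 ?addr0// => l lk; rewrite !mxE eq_sym (negPf lk) andbF.
by rewrite !mulr0.
Qed.

Lemma Hgrad3_p3field c : Hgrad3 Om (p3field c).
Proof. by move=> k; rewrite comp_p3field; exact: Hgrad_pfield. Qed.

Lemma Hcurl_efield u : Hcurl Om (efield u).
Proof.
have dE t x y z : dotv (efield u t x) (y - z) = \sum_e u e *
    dotv (whitney e t x) (y - z).
  by rewrite dotv_suml; apply: eq_bigr => e _; rewrite dotvZl.
have aL t i := affine_lam t i.
split.
- move=> t; apply: affinev_lincomb_rotation => e.
  by apply: wform_rotation; exact: aL.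
- move=> t t' x y z [tx t'x] [ty t'y] [tz t'z]; rewrite !dE.
  apply: eq_bigr => e _; rewrite !whitneyE !wform_dotv ?aL//.
  by rewrite !(lam_glue _ tx t'x) !(lam_glue _ ty t'y) !(lam_glue _ tz t'z).
- move=> t F Ft Fb x y z Fx Fy Fz; rewrite dE big1// => e _.
  rewrite whitneyE wform_dotv ?aL//.
  have l0 i w : i \notin F -> simplex F w -> lam i t w = 0.
    by move=> iF /(simplexP (@tinj t) (@tfree t) _ Ft)/(_ i)[_]; exact.
  (* An interior edge has an endpoint outside a boundary face F; the coordinate of that endpoint
     vanishes on F, and with it the tangential component. *)
  have : ((val e).1 \notin F) || ((val e).2 \notin F).
    rewrite -negb_and; apply/negP => /andP[iF jF].
    have /and3P[_ _ /asboolPn] := valP e; apply.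
    apply: subset_trans Fb; apply: simplex_sub.
    by apply/fintype.subsetP => k; rewrite !inE => /orP[]/eqP->.
  by move=> /orP[/l0 h|/l0 h]; rewrite !h// ?(subrr, mulr0, mul0r).
Qed.

Lemma Rintegral01_affine (a b : R) :
  \int[lebesgue_measure]_(s in `[0%R, 1%R]) (a + b * s) = a + b / 2.
Proof.
have iC (c : R) : lebesgue_measure.-integrable `[0%R, 1%R] (EFin \o (fun=> c)).
  apply: continuous_compact_integrable; first exact: segment_compact.
  by apply: continuous_subspaceT => x; exact: cst_continuous.
have iX : lebesgue_measure.-integrable `[0%R, 1%R]
    (EFin \o (fun s : R => unstable.onem s ^+ 1)).
  apply: continuous_compact_integrable; first exact: segment_compact.
  apply: continuous_subspaceT => x; rewrite /unstable.onem.
  by apply: cvgB; [exact: cvg_cst|exact: cvg_id].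
(* Rewritten in powers of 1 - s, for which [Rintegral_onemXn] gives the integral. *)
transitivity (\int[lebesgue_measure]_(s in `[0%R, 1%R])
    ((a + b) + (- b) * unstable.onem s ^+ 1)).
  by apply: eq_Rintegral => s _; rewrite /unstable.onem expr1; ring.
rewrite RintegralD//; last first.
  apply: continuous_compact_integrable; first exact: segment_compact.
  apply: continuous_subspaceT => x; rewrite /unstable.onem.
  by apply: cvgM; [exact: cvg_cst|apply: cvgB; [exact: cvg_cst|exact: cvg_id]].
have l1 : lebesgue_measure (`[0%R, 1%R] : set R) = 1%:E.
  by rewrite lebesgue_measure_itv /= lte_fin ltr01 -EFinB subr0.
rewrite RintegralZl// Rintegral_onemXn Rintegral_cst//.
transitivity ((a + b) * fine (1%:E) + - b * 2^-1); last by rewrite /=; field.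
by congr (_ * fine _ + _); exact: l1.
Qed.

(** The tangential integral along [ij] seen from t, by the trapezoidal rule, which is exact for
    affine fields. *)
Definition edof (t : T) (ij : V * V) (v : vfield M) : R :=
  dotv (v t (vt ij.1) + v t (vt ij.2)) (vt ij.2 - vt ij.1) / 2.

(** The tetrahedron is the one picked by [dof]. It serves all fields v at once, so linearity passes
    from [edof] to [dof]. *)
Lemma dof_edof (e : iedge) : exists t,
  [/\ (val e).1 \in tverts t, (val e).2 \in tverts t &
      forall v : vfield M, (forall t, affinev (v t)) -> dof e v = edof t (val e) v].
Proof.
rewrite /dof; case: pickP => [t /andP[t1 t2]|/(_ _)h]; last first.
  by have /and3P[_ /existsP[t]] := valP e; rewrite h.
exists t; split=> // v av; rewrite /edof.
set a := vt _; set b := vt _; set i := (val e).1.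
have ag : affine (fun x => dotv (v t x) (b - a)).
  have [h _] := affine_lincomb (index_enum 'I_3) predT (fun k => (b - a) 0 k) (av t).
  rewrite (_ : (fun x => _) = fun x => \sum_k (b - a) 0 k * v t x 0 k)//.
  by apply/funext => x; apply: eq_bigr => k _; rewrite mulrC.
set g := fun x => dotv (v t x) (b - a) in ag.
transitivity (\int[lebesgue_measure]_(s in `[0%R, 1%R]) (g a + (g b - g a) * s)).
  apply: eq_Rintegral => s _; rewrite -/(g _).
  have [c [d gE]] := ag; rewrite !gE !dotvDr dotvZr dotvBr; ring.
by rewrite Rintegral01_affine dotvDl -/(g a) -/(g b); field.
Qed.

(** The increasing pairs of vertices of t: boundary edges are included, unlike in [iedge]. *)
Definition tedge (t : T) : pred (V * V) :=
  [pred ij : V * V | [&& (ij.1 < ij.2)%N, ij.1 \in tverts t & ij.2 \in tverts t]].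

(** A crude count by all 4 * 4 pairs of vertices; every later factor 16 comes from here. *)
Lemma card_tedge t : (#|tedge t| <= 16)%N.
Proof.
have -> : 16%N = #|finset.setX (tverts t) (tverts t)|.
  by rewrite cardsX card_imset ?card_ord//; exact: tinj.
apply: subset_leq_card; apply/fintype.subsetP => -[i j] /and3P[_ it jt].
by rewrite inE it jt.
Qed.

Lemma whitney0 e t x : ~~ tedge t (val e) -> @whitney R Om M e t x = 0.
Proof.
have /and3P[ij _ _] := valP e; rewrite /tedge /= ij /= negb_and whitneyE /wform.
by move=> /orP[]h; rewrite (lam_notin x h) (gradf_lam_notin x h) scale0r scaler0 subr0.
Qed.

(** When the coefficients extend by zero to boundary edges, the sum over interior edges becomes on t
    a sum over all edges of t. There the reproduction of gradients and the element estimates hold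
    whatever the position of t relative to the boundary. *)
Lemma efield_local t (u : iedge -> R) (G : V * V -> R) :
  (forall e, tedge t (val e) -> u e = G (val e)) ->
  (forall ij, tedge t ij -> simplex [set ij.1; ij.2]%SET `<=` bdry Om -> G ij = 0) ->
  efield u t = fun x =>
    \sum_(ij | tedge t ij) G ij *: wform (lam ij.1 t) (lam ij.2 t) x.
Proof.
move=> uG G0; apply/funext => x.
rewrite (bigID (@is_iedge R Om M)) /= [X in _ = _ + X]big1 ?addr0; last first.
  move=> ij /andP[tij nij]; have /and3P[ij1 it jt] := tij.
  rewrite G0 ?scale0r//; apply: contrapT => nb; move/negP: nij; apply.
  apply/and3P; split=> //; last exact/asboolPn.
  by apply/fintype.existsP; exists t; rewrite it jt.
rewrite /efield (bigID (fun e : iedge => tedge t (val e))) /=.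
rewrite [X in _ + X]big1 ?addr0; last by move=> e /whitney0 ->; rewrite scaler0.
under eq_bigr => e te do rewrite uG// whitneyE.
symmetry; under eq_bigl do rewrite andbC.
exact: big_sub_cond.
Qed.

End Mesh.

(** * Degrees of freedom and nodal values *)

Section Dof.
Context {R : realType}.
Variables (Om : set 'rV[R]_3) (M : mesh R).
Local Notation V := 'I_(nvert M).
Local Notation T := 'I_(ntet M).
Local Notation vt := (@vert R M).
Local Notation ivert := (ivert Om M).
Local Notation iedge := (iedge Om M).
Hypothesis opOm : open Om.
Hypothesis triM : triangulates Om M.

Let tinj := tet_injP triM.
Let tfree := tet_freeP triM.
Let aL t i : affine (@lam R M i t) := affine_lam t i.

(* With T i j = (f_j - f_i) lam_i grad lam_j the summand is T i j + T j i, so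
   that the sum over i < j is the sum of T over all pairs of vertices. *)
Lemma sum_wform_grad t f x : affine f ->
  \sum_(ij : V * V | tedge t ij)
     (f (vt ij.2) - f (vt ij.1)) *: wform (lam ij.1 t) (lam ij.2 t) x = gradf f x.
Proof.
move=> af.
pose D i := gradf (@lam R M i t) x.
pose S (ij : V * V) := ((f (vt ij.2) - f (vt ij.1)) * lam ij.1 t x) *: D ij.2.
pose sw (ij : V * V) := (ij.2, ij.1).
have swK : involutive sw by case.
have S0 ij : ~~ [&& ij.1 \in tverts t & ij.2 \in tverts t] -> S ij = 0.
  rewrite negb_and => /orP[h|h]; first by rewrite /S (lam_notin _ h) mulr0 scale0r.
  by rewrite /S /D (gradf_lam_notin _ h) scaler0.
transitivity (\sum_(ij : V * V | (ij.1 < ij.2)%N) (S ij + S (sw ij))).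
  rewrite [RHS](bigID (fun ij : V * V => [&& ij.1 \in tverts t & ij.2 \in tverts t])) /=.
  rewrite [X in _ = _ + X]big1 ?addr0; last first.
    move=> ij /andP[_ h]; rewrite !S0 ?addr0//= andbC //.
  apply: eq_bigr => ij _; rewrite /S /wform /D /= scalerBr !scalerA.
  by congr (_ + _); rewrite -scaleNr; congr (_ *: _); ring.
rewrite big_split /= [X in _ + X](reindex_inj (inv_inj swK)) /=.
under [X in _ + X]eq_bigr do rewrite swK.
transitivity (\sum_ij S ij).
  rewrite [RHS](bigID (fun ij : V * V => (ij.1 < ij.2)%N)) /=; congr (_ + _).
  rewrite [RHS](bigID (fun ij : V * V => (ij.2 < ij.1)%N)) /=.
  rewrite [X in _ = _ + X]big1 ?addr0; last first.
    move=> [i j] /=; rewrite -!leqNgt => /andP[ji ij].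
    have -> : i = j by apply/val_inj/eqP; rewrite eqn_leq ij ji.
    by rewrite /S subrr mul0r scale0r.
  by apply: eq_bigl => -[i j] /=; case: ltngtP.
rewrite -(pair_bigA _ (fun i j => S (i, j))) /S /=.
transitivity (\sum_i \sum_j ((lam i t x * f (vt j)) *: D j
    - (f (vt i) * lam i t x) *: D j)).
  apply: eq_bigr => i _; apply: eq_bigr => j _.
  by rewrite -scalerBl; congr (_ *: _); ring.
under eq_bigr do rewrite sumrB -[X in _ - X]scaler_sumr (sum_gradf_lam (@tinj t) (@tfree t))
  scaler0 subr0.
rewrite exchange_big /= (gradf_sum_lam (@tinj t) (@tfree t) x af).
apply: eq_bigr => j _; rewrite -scaler_suml -mulr_suml.
by rewrite (lam_sum1 (@tinj t) (@tfree t)) mul1r.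
Qed.

Lemma edof_grad t ij (p : sfield M) : affine (p t) ->
  edof t ij (@grad R M p) = p t (vt ij.2) - p t (vt ij.1).
Proof.
move=> ap; rewrite /edof /grad dotvDl (gradf_cst (vt ij.1) 0 ap)
  (gradf_cst (vt ij.2) 0 ap) -(affine_diff _ _ 0 ap); by field.
Qed.

Lemma edof_lincomb (I : finType) t ij (c : I -> R) (F : I -> vfield M) :
  edof t ij (fun t x => \sum_i c i *: F i t x) = \sum_i c i * edof t ij (F i).
Proof.
rewrite /edof -big_split /= dotv_suml mulr_suml; apply: eq_bigr => i _.
by rewrite -scalerDr dotvZl mulrA.
Qed.

Lemma edofD t ij (v w : vfield M) :
  edof t ij (fun t x => v t x + w t x) = edof t ij v + edof t ij w.
Proof. by rewrite /edof !dotvDl; field. Qed.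

(** [edof] involves only tangential components at the endpoints of a shared edge, and these are
    continuous. *)
Lemma edof_glue t t' ij (w : vfield M) : Hcurl Om w -> tedge t ij -> tedge t' ij ->
  edof t ij w = edof t' ij w.
Proof.
move=> [_ h _] /and3P[_ it jt] /and3P[_ it' jt'].
have H k : k \in tverts t -> k \in tverts t' -> (elt t `&` elt t') (vt k).
  by move=> kt kt'; split; apply: elt_vert.
rewrite /edof !dotvDl; congr ((_ + _) / _); apply: h; exact: H.
Qed.

Lemma dof_tedge t (e : iedge) (w : vfield M) : Hcurl Om w -> tedge t (val e) ->
  dof e w = edof t (val e) w.
Proof.
move=> wH te; have [t' [it jt ->]] := dof_edof e.
  apply: edof_glue => //; have /and3P[ij _ _] := te.
  by rewrite /tedge /= ij it jt.
exact: affinev_Hcurl wH.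
Qed.

Lemma nodal_glue t t' i (p : sfield M) : Hgrad Om p -> i \in tverts t ->
  i \in tverts t' -> p t (vt i) = p t' (vt i).
Proof. by move=> [_ h _] it it'; apply: h; exact: elt_vert. Qed.

Lemma Hgrad3_nodal_glue t t' i (v : vfield M) : Hgrad3 Om v -> i \in tverts t ->
  i \in tverts t' -> v t (vt i) = v t' (vt i).
Proof. by move=> vH it it'; apply/rowP => k; exact: (nodal_glue (vH k)). Qed.

Lemma Hgrad3_dof_tedge t (e : iedge) (v : vfield M) : Hgrad3 Om v ->
  tedge t (val e) -> dof e v = edof t (val e) v.
Proof.
move=> vH /and3P[_ i1 j1]; have [t' [it jt ->]] := dof_edof e.
  by rewrite /edof (Hgrad3_nodal_glue vH it i1) (Hgrad3_nodal_glue vH jt j1).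
exact: affinev_Hgrad3 vH.
Qed.

Lemma Hgrad3_edof_bdry t ij (v : vfield M) : Hgrad3 Om v -> tedge t ij ->
  simplex [set ij.1; ij.2]%SET `<=` bdry Om -> edof t ij v = 0.
Proof.
move=> vH /and3P[_ it jt] sb.
have v0 k : k \in tverts t -> k \in [set ij.1; ij.2]%SET -> v t (vt k) = 0.
  move=> kt kij; apply/rowP => l; have [_ _ h] := vH l; rewrite mxE.
  by apply: h; [exact: elt_vert|apply: sb; exact: vert_simplex].
by rewrite /edof !v0 ?inE ?eqxx ?orbT// addr0 dotv0l mul0r.
Qed.

Lemma dof_lincomb (I : finType) (e : iedge) (c : I -> R) (F : I -> vfield M) :
  (forall i t, affinev (F i t)) ->
  dof e (fun t x => \sum_i c i *: F i t x) = \sum_i c i * dof e (F i).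
Proof.
move=> aF; have [t [_ _ h]] := dof_edof e.
rewrite h => [|t']; last by have [] := affinev_lincomb (index_enum I) predT c
  (aF ^~ t').
by rewrite edof_lincomb; apply: eq_bigr => i _; rewrite h.
Qed.

Lemma dofD (e : iedge) (v w : vfield M) :
  (forall t, affinev (v t)) -> (forall t, affinev (w t)) ->
  dof e (fun t x => v t x + w t x) = dof e v + dof e w.
Proof.
move=> av aw; have [t [_ _ h]] := dof_edof e.
rewrite !h//; first exact: edofD.
move=> t' k; have [g _] := affineD2 1 1 (av t' k) (aw t' k).
rewrite (_ : (fun x => _) = fun x => 1 * v t' x 0 k + 1 * w t' x 0 k)//.
by apply/funext => x; rewrite !mul1r mxE.
Qed.

Lemma dof_whitney (e e' : iedge) : dof e (whitney e') = (e == e')%:R.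
Proof.
have [t [it jt ->]] := dof_edof e; last exact: affinev_whitney.
have /and3P[ij _ _] := valP e; have /and3P[ij' _ _] := valP e'.
rewrite /edof whitneyE dotvDl !wform_dotv ?aL//.
have -> : (e == e') = ((val e').1 == (val e).1) && ((val e').2 == (val e).2).
  by rewrite -val_eqE; case: (val e) (val e') => [i j] [k l];
    rewrite -pair_eqE /pair_eq /= (eq_sym i) (eq_sym j).
rewrite !(lam_vert (@tinj t) (@tfree t))//.
move: (val e).1 (val e).2 (val e').1 (val e').2 ij ij' => i j k l ij kl.
(* The reversed edge would contribute -1; it is excluded as both pairs are increasing. *)
have kjli : (k == j) && (l == i) = false.
  by apply/negP => /andP[/eqP kj /eqP li]; move: kl; rewrite kj li ltnNge ltnW.
have ij0 : i != j by apply: contraL ij => /eqP ->; rewrite ltnn.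
have kij : (k == i) && (k == j) = false.
  by apply/negP => /andP[/eqP-> /eqP e2]; rewrite e2 eqxx in ij0.
have lij : (l == i) && (l == j) = false.
  by apply/negP => /andP[/eqP-> /eqP e2]; rewrite e2 eqxx in ij0.
move: kjli kij lij; case: (k == i); case: (k == j); case: (l == i);
  case: (l == j) => //= _ _ _; by field.
Qed.

Lemma dof_efield (u : iedge -> R) e : dof e (efield u) = u e.
Proof.
rewrite dof_lincomb; last exact: affinev_whitney.
rewrite (bigD1 e)//= dof_whitney eqxx mulr1 big1 ?addr0// => e' ee.
by rewrite dof_whitney eq_sym (negPf ee) mulr0.
Qed.

(** The coefficient of grad p on an edge is the difference of its end values. It vanishes on
    boundary edges, so the sum may run over all edges of t, where [sum_wform_grad] returns the
    gradient. *)
Lemma efield_grad (p : sfield M) : Hgrad Om p ->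
  forall t x, efield (fun e : iedge => dof e (@grad R M p)) t x = @grad R M p t x.
Proof.
move=> pH t x; have [ap pg pb] := pH.
rewrite (@efield_local _ _ _ t _ (fun ij => p t (vt ij.2) - p t (vt ij.1))).
- exact: sum_wform_grad.
- move=> e /and3P[_ i1 j1]; have [t' [it jt ->]] := dof_edof e.
    by rewrite edof_grad// (nodal_glue pH it i1) (nodal_glue pH jt j1).
  by move=> t2; exact: affinev_grad.
- move=> ij /and3P[_ it jt] sb.
  by rewrite !pb ?subrr//; try exact: elt_vert;
    apply: sb; apply: vert_simplex; rewrite !inE eqxx ?orbT.
Qed.

(** For continuous p the choice of t is immaterial, and on a triangulation the default is never
    reached, every vertex being in some tetrahedron. *)
Definition nodal (p : sfield M) (i : ivert) : R :=
  if [pick t | val i \in tverts t] is Some t then p t (vt (val i)) else 0.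

Lemma nodalE t (p : sfield M) i : Hgrad Om p -> val i \in tverts t ->
  nodal p i = p t (vt (val i)).
Proof.
move=> pH it; rewrite /nodal; case: pickP => [t' it'|/(_ t)]; last by rewrite it.
exact: nodal_glue.
Qed.

Lemma Hgrad_nodal (p : sfield M) : Hgrad Om p -> p = pfield (nodal p).
Proof.
move=> pH; have [ap _ pb] := pH.
apply/funext => t; apply/funext => x; rewrite /pfield.
rewrite (sum_lam_affine (@tinj t) (@tfree t) x (ap t)).
rewrite (bigID (fun i : V => vt i \in Om)) /= [X in _ + X]big1 ?addr0; last first.
  move=> i iO; have [it|it] := boolP (i \in tverts t); last first.
    by rewrite (lam_notin x it) mulr0.
  (* A vertex outside Om lies in the closure of Om but not in its interior, hence on the boundary,
     where p vanishes. *)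
  rewrite pb ?mul0r//; first exact: elt_vert.
  split; last by move=> /interior_subset; move: iO; rewrite notin_setE.
  have [_ _ _ -> _] := triM; exists t => //; exact: elt_vert.
rewrite (big_sub (fun i : V => vt i \in Om) (fun i => p t (vt i) * lam i t x)).
apply: eq_bigr => i _; rewrite /hat.
have [it|it] := boolP (val i \in tverts t); first by rewrite (nodalE pH it).
by rewrite (lam_notin x it) !mulr0.
Qed.

Lemma Hgrad3_nodal (v : vfield M) : Hgrad3 Om v ->
  v = p3field (fun ik => nodal (Defs.comp ik.2 v) ik.1).
Proof.
move=> vH; apply/funext => t; apply/funext => x; apply/rowP => k.
have := congr1 (fun p => p t x) (Hgrad_nodal (vH k)).
rewrite /Defs.comp => ->.
by have /(congr1 (fun p => p t x)) <- :=
  comp_p3field (fun ik => nodal (Defs.comp ik.2 v) ik.1) k.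
Qed.

End Dof.

(** * Bilinear forms *)

Section Forms.
Context {R : realType}.
Variables (Om : set 'rV[R]_3) (M : mesh R).
Local Notation V := 'I_(nvert M).
Local Notation T := 'I_(ntet M).
Local Notation vt := (@vert R M).
Local Notation ivert := (ivert Om M).
Local Notation iedge := (iedge Om M).
Hypothesis triM : triangulates Om M.

Let tinj := tet_injP triM.
Let tfree := tet_freeP triM.
Let rE (t : T) : region (elt t) := region_elt (@tinj t) (@tfree t).

Lemma integral3_sum K (I : finType) (F : I -> 'rV[R]_3 -> R) : region K ->
  (forall i, tame (F i)) ->
  integral3 K (fun x => \sum_i F i x) = \sum_i integral3 K (F i).
Proof.
move=> rK tF.
elim: (index_enum I) => [|i r IH].
  rewrite big_nil; under eq_fun do rewrite big_nil.
  by rewrite integral3_cst// mul0r.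
rewrite big_cons; under eq_fun do rewrite big_cons.
by rewrite integral3D// ?IH//; exact: tame_sum.
Qed.

Lemma integral3_sum2 K (I : finType) (c d : I -> R)
    (F : I -> I -> 'rV[R]_3 -> R) : region K -> (forall i j, tame (F i j)) ->
  integral3 K (fun x => \sum_i \sum_j c i * d j * F i j x)
  = \sum_i \sum_j c i * d j * integral3 K (F i j).
Proof.
move=> rK tF.
have tcF i j : tame (fun x => c i * d j * F i j x).
  by apply: tameM => //; exact: tame_cst.
rewrite integral3_sum// => [|i]; last exact: tame_sum.
apply: eq_bigr => i _; rewrite integral3_sum//.
by apply: eq_bigr => j _; rewrite integral3Z.
Qed.

Lemma vL2_lincomb (I : finType) (c d : I -> R) (F : I -> vfield M) :
  (forall i t, tamev (F i t)) ->
  vL2 (fun t x => \sum_i c i *: F i t x) (fun t x => \sum_i d i *: F i t x)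
  = \sum_i \sum_j c i * d j * vL2 (F i) (F j).
Proof.
move=> tF; rewrite /vL2.
under [RHS]eq_bigr do under eq_bigr do rewrite mulr_sumr.
under [RHS]eq_bigr do rewrite exchange_big.
rewrite [RHS]exchange_big; apply: eq_bigr => t _ /=.
rewrite -integral3_sum2//; last by move=> i j; exact: tame_dotv.
congr integral3; apply/funext => x; rewrite dotv_suml; apply: eq_bigr => i _.
rewrite dotv_sumr; apply: eq_bigr => j _.
by rewrite dotvZl dotvZr mulrA.
Qed.

Lemma sL2_lincomb (I : finType) (c d : I -> R) (F : I -> sfield M) :
  (forall i t, tame (F i t)) ->
  sL2 (fun t x => \sum_i c i * F i t x) (fun t x => \sum_i d i * F i t x)
  = \sum_i \sum_j c i * d j * sL2 (F i) (F j).
Proof.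
move=> tF; rewrite /sL2.
under [RHS]eq_bigr do under eq_bigr do rewrite mulr_sumr.
under [RHS]eq_bigr do rewrite exchange_big.
rewrite [RHS]exchange_big; apply: eq_bigr => t _ /=.
rewrite -integral3_sum2//; last by move=> i j; exact: tameM.
congr integral3; apply/funext => x; rewrite mulr_suml; apply: eq_bigr => i _.
rewrite mulr_sumr; apply: eq_bigr => j _; ring.
Qed.

Lemma vL2_ge0 (v : vfield M) : 0 <= vL2 v v.
Proof. by apply: sumr_ge0 => t _; apply: integral3_ge0 => x _; exact: dotvv_ge0. Qed.

Lemma sL2_ge0 (v : sfield M) : 0 <= sL2 v v.
Proof.
by apply: sumr_ge0 => t _; apply: integral3_ge0 => x _; rewrite -expr2 sqr_ge0.
Qed.

Lemma grad3L2_ge0 (v : vfield M) : 0 <= grad3L2 v v.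
Proof. by apply: sumr_ge0 => k _; exact: vL2_ge0. Qed.

Lemma vL2C (v w : vfield M) : vL2 v w = vL2 w v.
Proof.
apply: eq_bigr => t _; congr integral3; apply/funext => x; exact: dotvC.
Qed.

Lemma sL2C (v w : sfield M) : sL2 v w = sL2 w v.
Proof.
apply: eq_bigr => t _; congr integral3; apply/funext => x; exact: mulrC.
Qed.

Definition coef (I : finType) (x : 'cV[R]_#|{: I}|) (i : I) : R := x (enum_rank i) 0.

Lemma coef_col (I : finType) (c : I -> R) : coef (\col_a c (enum_val a)) = c.
Proof. by apply/funext => i; rewrite /coef mxE enum_rankK. Qed.

Lemma fmatrix_tr (I : finType) (f : I -> I -> R) : (forall i j, f i j = f j i) ->
  (fmatrix f)^T = fmatrix f.
Proof. by move=> fs; apply/matrixP => a b; rewrite !mxE. Qed.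

Lemma bform_fmatrix (I : finType) (f : I -> I -> R) x y :
  bform (fmatrix f) x y = \sum_i \sum_j coef x i * coef y j * f i j.
Proof.
rewrite bform_sum (big_enum_val (fun i => \sum_j coef x i * coef y j * f i j)).
apply: eq_bigr => a _.
rewrite (big_enum_val (fun j => coef x (enum_val a) * coef y j * f (enum_val a) j)).
by apply: eq_bigr => b _; rewrite /coef !enum_valK mxE.
Qed.

Lemma coef_mul (I J : finType) (f : I -> J -> R) (x : 'cV[R]_#|{: J}|) i :
  coef (fmatrix f *m x) i = \sum_j coef x j * f i j.
Proof.
rewrite /coef mxE (big_enum_val (fun j => coef x j * f i j)).
by apply: eq_bigr => b _; rewrite mxE enum_rankK /coef enum_valK mulrC.
Qed.

Lemma bform_curl eps x y : bform (A_curl Om M eps) x y =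
  vL2 (@curl R M (efield (coef x))) (@curl R M (efield (coef y)))
  + eps * vL2 (efield (coef x)) (efield (coef y)).
Proof.
rewrite bform_fmatrix /=.
under eq_bigr do under eq_bigr do rewrite mulrDr mulrCA.
under eq_bigr do rewrite big_split /= -mulr_sumr.
rewrite big_split /= -mulr_sumr -(vL2_lincomb _ _ (F := @whitney R Om M)); last first.
  by move=> e t; apply: tame_affinev; exact: affinev_whitney.
rewrite -(vL2_lincomb _ _ (F := fun e => @curl R M (whitney e))); last first.
  move=> e t; apply: tame_affinev => k; exists (curlf (whitney e t) 0 0 k), 0.
  by move=> z; rewrite dotv0l addr0 /curl (curlf_cst z 0 (affinev_whitney e t)).
congr (vL2 _ _ + _); apply/funext => t; apply/funext => z; rewrite /curl.
  by have [_ ->] := affinev_lincomb (index_enum iedge) predT (coef x)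
    (fun e => @affinev_whitney _ _ _ e t).
by have [_ ->] := affinev_lincomb (index_enum iedge) predT (coef y)
    (fun e => @affinev_whitney _ _ _ e t).
Qed.

Lemma grad_lincomb (I : finType) (c : I -> R) (F : I -> sfield M) :
  (forall i t, affine (F i t)) ->
  @grad R M (fun t x => \sum_i c i * F i t x)
  = fun t x => \sum_i c i *: @grad R M (F i) t x.
Proof.
move=> aF; apply/funext => t; apply/funext => x.
have [_ h] := affine_lincomb (index_enum I) predT c (aF ^~ t).
exact: h.
Qed.

Lemma vL2_grad_lincomb (I : finType) (c d : I -> R) (F : I -> sfield M) :
  (forall i t, affine (F i t)) ->
  vL2 (@grad R M (fun t x => \sum_i c i * F i t x))
      (@grad R M (fun t x => \sum_i d i * F i t x))
  = \sum_i \sum_j c i * d j * vL2 (@grad R M (F i)) (@grad R M (F j)).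
Proof.
move=> aF; rewrite !grad_lincomb// vL2_lincomb// => i t.
by apply: tame_affinev; apply: affinev_grad.
Qed.

Lemma affine_hat (i : ivert) t : affine (hat i t).
Proof. exact: affine_lam. Qed.

Lemma bform_grad eps x y : bform (A_grad Om M eps) x y =
  vL2 (@grad R M (pfield (coef x))) (@grad R M (pfield (coef y)))
  + eps * sL2 (pfield (coef x)) (pfield (coef y)).
Proof.
rewrite bform_fmatrix /=.
under eq_bigr do under eq_bigr do rewrite mulrDr mulrCA.
under eq_bigr do rewrite big_split /= -mulr_sumr.
rewrite big_split /= -mulr_sumr -(sL2_lincomb _ _ (F := @hat R Om M)); last first.
  by move=> i t; apply: tame_affine; exact: affine_hat.
by rewrite -vL2_grad_lincomb//; exact: affine_hat.
Qed.

Lemma bform_grad3 eps x y : bform (A_grad3 Om M eps) x y =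
  grad3L2 (p3field (coef x)) (p3field (coef y))
  + eps * vL2 (p3field (coef x)) (p3field (coef y)).
Proof.
rewrite bform_fmatrix /=.
under eq_bigr do under eq_bigr do rewrite mulrDr mulrCA.
under eq_bigr do rewrite big_split /= -mulr_sumr.
rewrite big_split /= -mulr_sumr -(vL2_lincomb _ _ (F := @hat3 R Om M)); last first.
  by move=> i t; apply: tame_affinev; exact: affinev_hat3.
congr (_ + _); rewrite /grad3L2.
under eq_bigr do under eq_bigr do rewrite mulr_sumr.
under eq_bigr do rewrite exchange_big.
rewrite exchange_big; apply: eq_bigr => k _ /=.
have e (c : ivert * 'I_3 -> R) : Defs.comp k (p3field c) =
    fun t z => \sum_i c i * Defs.comp k (hat3 i) t z.
  apply/funext => t; apply/funext => z; rewrite /Defs.comp /p3field summxE.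
  by apply: eq_bigr => i _; rewrite mxE.
by rewrite !e vL2_grad_lincomb// => i t; exact: (affinev_hat3 i t k).
Qed.

End Forms.

(** * Shape-regular meshes *)

Lemma affine_continuous (R : realType) (f : 'rV[R]_3 -> R) : affine f -> continuous f.
Proof.
move=> [a [b fE]]; rewrite (_ : f = fun x => a + (b 0 0 * x 0 0 + b 0 1 * x 0 1
  + b 0 2%:R * x 0 2%:R)); last by apply/funext => x; rewrite fE dotvE.
move=> x; have h i : (fun y : 'rV[R]_3 => b 0 i * y 0 i) y @[y --> x] --> b 0 i * x 0 i.
  exact: cvgM (cvg_cst _) (@coord_continuous _ _ _ 0 i x).
exact: cvgD (cvg_cst _) (cvgD (cvgD (h 0) (h 1)) (h 2%:R)).
Qed.

(** Any bound will do, so e <= 1 + e^2 replaces taking a root. *)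
Lemma enorm_le_of_coord (R : realType) (x : 'rV[R]_3) B :
  (forall i, `|x 0 i| <= B) -> enorm x <= 1 + 3 * B ^+ 2.
Proof.
move=> xB; have B0 : 0 <= B by apply: le_trans (xB 0).
have h i : x 0 i * x 0 i <= B ^+ 2.
  rewrite -expr2 -[x 0 i ^+ 2]real_normK ?num_real// ler_pXn2r ?nnegrE//.
have := sqr_enorm x; rewrite dotvE; move: (h 0) (h 1) (h 2%:R) (enorm_ge0 x).
move: (enorm x) => e; nra.
Qed.

(** All tetrahedra lie in the closure of Om, so H depends on Om alone and may enter the final
    constant. It absorbs the mass part of the Jacobi estimate, which is of lower order in 1/r. *)
Lemma triangulated_diam_bound (R : realType) (Om : set 'rV[R]_3) : bounded_set Om ->
  exists2 H : R, 0 <= H & forall (M : mesh R) t (x y : 'rV[R]_3), triangulates Om M ->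
    elt t x -> @elt R M t y -> enorm (x - y) <= H.
Proof.
(* Norms in Om are at most |B| + 1; one unit is added for a strict ball and one for the closure. *)
move=> [B [_ bB]]; pose C := `|B| + 3.
have OmC (x : 'rV[R]_3) i : Om x -> `|x 0 i| <= `|B| + 2.
  have Blt : B < `|B| + 1 by rewrite (le_lt_trans (ler_norm _))// ltrDl.
  move=> Ox; have xB : `|x| <= `|B| + 1 by exact: (bB _ Blt x Ox).
  have : ball (0 : 'rV[R]_3) (`|B| + 2) x.
    by rewrite -ball_normE /= sub0r normrN (le_lt_trans xB)// ltrD2l ltr1n.
  move=> [_ /(_ 0 i)]; rewrite -ball_normE /= mxE sub0r normrN; exact: ltW.
have clC (x : 'rV[R]_3) i : closure Om x -> `|x 0 i| <= C.
  move=> /(_ (ball x 1))[|y [Oy [_ xy]]]; first exact: nbhsx_ballx.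
  have := OmC y i Oy; have := xy 0 i; rewrite -ball_normE /= => h1 h2.
  have : `|x 0 i| <= `|x 0 i - y 0 i| + `|y 0 i|.
    by rewrite -{1}[x 0 i](subrK (y 0 i)) ler_normD.
  rewrite /C; lra.
exists (1 + 3 * (C + C) ^+ 2); first by rewrite addr_ge0// mulr_ge0// sqr_ge0.
move=> M t x y [_ _ _ cE _] tx ty; apply: enorm_le_of_coord => i.
rewrite !mxE (le_trans (ler_normB _ _))// lerD// clC// cE; by exists t.
Qed.

Section Connected.
Context {R : realType}.
Variables (Om : set 'rV[R]_3) (M : mesh R).
Local Notation V := 'I_(nvert M).
Local Notation T := 'I_(ntet M).
Local Notation vt := (@vert R M).
Hypothesis opOm : open Om.
Hypothesis triM : triangulates Om M.

Let tinj := tet_injP triM.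
Let tfree := tet_freeP triM.

Lemma closed_elt (t : T) : closed (elt t).
Proof.
rewrite (_ : elt t = \bigcap_(i in [set: V]) (lam i t @^-1` [set y | 0 <= y])).
  apply: closed_bigI => i _; apply: preimage_closed; last exact: closed_ge.
  by move=> x _; apply: affine_continuous; exact: affine_lam.
apply/seteqP; split=> [x /(eltP (@tinj t) (@tfree t)) h i _|x h]; first exact: h.
by apply/(eltP (@tinj t) (@tfree t)) => i; exact: h.
Qed.

(* A vertex with maximal first coordinate in the region where p takes a nonzero
   value c lies in the open set Om away from the tetrahedra with another value,
   so the region extends beyond it. *)
Lemma Hgrad_grad0 (p : sfield M) : Hgrad Om p ->
  (forall t, gradf (p t) 0 = 0) -> forall t x, p t x = 0.
Proof.
move=> [ap pg pb] g0 t0 x0.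
have pc t x : p t x = p t 0 by rewrite (affineE x (ap t)) g0 dotv0l addr0.
apply/eqP; apply: contraT => nz; set c := p t0 x0 in nz.
have [k0 _] : exists k : 'I_4, true by exists 0.
pose P := [pred it : V * T | (it.1 \in tverts it.2) && (p it.2 0 == c)].
have P0 : P (tet t0 k0, t0) by rewrite /P /= mem_tverts /c pc eqxx.
case: (arg_maxP (fun it : V * T => vt it.1 0 0) P0) => -[v t] /= /andP[vt' /eqP ptc] vmax.
set m := vt v 0 0 in vmax.
have le_m t' x : elt t' x -> p t' 0 = c -> x 0 0 <= m.
  move=> /(eltP (@tinj t') (@tfree t')) tx pt'c.
  rewrite -[x in leLHS](lam_sumE (@tinj t') (@tfree t')) summxE.
  rewrite -[m]mul1r -(lam_sum1 (@tinj t') (@tfree t') x) mulr_suml.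
  apply: ler_sum => i _; rewrite mxE.
  have [it|it] := boolP (i \in tverts t'); last by rewrite (lam_notin _ it) !mul0r.
  apply: ler_wpM2l; first exact: tx.
  by apply: (vmax (i, t')); rewrite /P /= it pt'c eqxx.
have tv : elt t (vt v) by exact: elt_vert.
have [_ _ _ cE _] := triM.
(* Outside Om the vertex would be on the boundary, where p is 0 and not c. *)
have Ov : Om (vt v).
  apply: contrapT => nO; move: nz; rewrite -ptc -(pc t (vt v)) pb ?eqxx//.
  split; last by move=> /interior_subset.
  by rewrite cE; exists t.
pose W := \bigcup_(t' in [set t' | p t' 0 != c]) elt t'.
have cW : closed W.
  by apply: closed_bigcup; [exact: finite_finset|move=> t' _; exact: closed_elt].
have nWv : ~ W (vt v).
  move=> [t' /= /negP pt' t'v]; apply: pt'; apply/eqP.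
  by rewrite -(pc t' (vt v)) (pg _ t _ t'v tv) pc.
have : nbhs (vt v) (Om `&` ~` W).
  by apply: open_nbhs_nbhs; split=> //; apply: openI => //; exact: closed_openC.
move=> /nbhs_ballP[r /= r0 rU].
pose y := vt v + (r / 2) *: delta_mx 0 0.
have [Oy nWy] : (Om `&` ~` W) y.
  apply: rU; split=> // i j; rewrite -ball_normE /= !mxE opprD addNKr normrN.
  rewrite ger0_norm; last by rewrite mulr_ge0 ?ler0n// ltW// divr_gt0.
  by case: (_ && _) => /=; lra.
have : closure Om y by exact: subset_closure.
rewrite cE => -[t' _ t'y].
have ptc' : p t' 0 = c.
  by apply: contrapT => /eqP ne; apply: nWy; exists t'.
have := le_m _ _ t'y ptc'; rewrite /y !mxE eqxx /= -/m; lra.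
Qed.

(** * A tetrahedron containing a ball *)

Section Shape.
Variables (sigma H : R) (t : T).
Hypothesis diamH : forall x y, elt t x -> elt t y -> enorm (x - y) <= H.
Variables (c : 'rV[R]_3) (r : R).
Hypothesis r_gt0 : 0 < r.
Hypothesis ball_elt : forall x, enorm (x - c) <= r -> elt t x.
Hypothesis diam_le : elt_diam t <= sigma * r.

Local Notation h := (elt_diam t).

(** [diam] is a supremum, which bounds its set only if that set is bounded above: this is what
    [diamH] provides. *)
Lemma elt_diam_ge x y : elt t x -> elt t y -> enorm (x - y) <= h.
Proof.
move=> tx ty; apply: ub_le_sup; last by exists x, y.
by exists H => _ [x' [y' [? ? ->]]]; exact: diamH.
Qed.

Lemma elt_center : elt t c.
Proof. by apply: ball_elt; rewrite subrr /enorm dotv0l sqrtr0 ltW. Qed.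

Lemma elt_diam_le : h <= H.
Proof.
apply: ge_sup => [|_ [x' [y' [? ? ->]]]]; last exact: diamH.
by exists (enorm (c - c)), c, c; split=> //; exact: elt_center.
Qed.

Lemma enormZ (a : R) (x : 'rV[R]_3) : 0 <= a -> enorm (a *: x) = a * enorm x.
Proof.
move=> a0; rewrite /enorm dotvZl dotvZr mulrA sqrtrM ?mulr_ge0//.
by rewrite -expr2 sqrtr_sqr ger0_norm.
Qed.

Lemma radius_le_diam : r <= h.
Proof.
have e1 : enorm (delta_mx 0 0 : 'rV[R]_3) = 1.
  by rewrite /enorm dotvE !mxE /= mulr1 !mulr0 !addr0 sqrtr1.
have e : enorm (c + r *: delta_mx 0 0 - c) = r.
  by rewrite addrC addKr enormZ ?ltW// e1 mulr1.
by rewrite -{1}e; apply: elt_diam_ge; [apply: ball_elt; rewrite e|exact: elt_center].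
Qed.

Lemma diam_gt0 : 0 < h. Proof. exact: lt_le_trans radius_le_diam. Qed.

Lemma sigma_gt0 : 0 < sigma.
Proof. by rewrite -(pmulr_lgt0 _ r_gt0); apply: lt_le_trans diam_le; exact: diam_gt0. Qed.

(** From the centre c to the point y of the sphere in the direction of the gradient g, [lam i]
    increases by r |g|, while staying in [0, 1]. *)
Lemma gradf_lam_le i : dotv (gradf (lam i t) 0) (gradf (lam i t) 0) * r ^+ 2 <= 1.
Proof.
have al := affine_lam t i; set g := gradf _ _.
have [->|g0] := eqVneq g 0; first by rewrite dotv0l mul0r ler01.
have gn0 : 0 < enorm g.
  rewrite lt_neqAle enorm_ge0 andbT eq_sym; apply: contra g0 => /eqP e.
  by apply/eqP/dotvv_eq0; rewrite -sqr_enorm e expr0n.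
pose y := c + (r / enorm g) *: g.
have ey : enorm (y - c) = r.
  rewrite /y addrC addKr enormZ ?divr_ge0 ?enorm_ge0 ?ltW//.
  by rewrite -mulrA mulVf ?mulr1// gt_eqF.
have ty : elt t y by apply: ball_elt; rewrite ey.
have := affine_diff y c 0 al; rewrite -/g /y addrAC subrr add0r dotvZr -/y.
rewrite -sqr_enorm -mulrA (_ : (enorm g)^-1 * _ = enorm g); last by field; rewrite gt_eqF.
have /(eltP (@tinj t) (@tfree t))/(_ i) := elt_center.
have := lam_le1 (@tinj t) (@tfree t) i ty.
move: (lam i t y) (lam i t c) => ly lc; move: (enorm g) gn0 => e e0 l1 l0 ee.
have re : r * e <= 1 by rewrite -ee; lra.
have : 0 <= r * e by rewrite mulr_ge0// ltW.
by move=> re0; rewrite -exprMn mulrC exprn_ile1.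
Qed.

Lemma cube_elt (x : 'rV[R]_3) : (forall i, `|x 0 i - c 0 i| <= r / 2) -> elt t x.
Proof.
move=> xc; apply: ball_elt.
rewrite -(@ler_pXn2r _ 2) ?nnegrE ?enorm_ge0 ?(ltW r_gt0)// sqr_enorm dotvE !mxE.
have hi i : (x 0 i - c 0 i) * (x 0 i - c 0 i) <= r ^+ 2 / 4.
  have -> : r ^+ 2 / 4 = (r / 2) ^+ 2 by field.
  have r20 : 0 <= r / 2 by rewrite divr_ge0// ltW.
  by rewrite -expr2 -[leLHS]real_normK ?num_real// ler_pXn2r ?nnegrE.
(* The cube of half-side r/2 fits in the ball because 3 (r/2)^2 <= r^2. *)
have := hi 0; have := hi 1; have := hi 2%:R; have := sqr_ge0 r; lra.
Qed.

Let rE : region (elt t) := region_elt (@tinj t) (@tfree t).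

Lemma volume_elt_le : volume (elt t) <= 8 * h ^+ 3.
Proof.
apply: (@volume_le_cube _ _ c); rewrite ?ltW ?diam_gt0// => x i tx.
have := coord_le_enorm (x - c) i; rewrite !mxE => /le_trans; apply.
by apply: elt_diam_ge => //; exact: elt_center.
Qed.

(** 512 = 8 * 64: the volume is at most 8 (sigma r)^3, and the corner of the inscribed cube has
    volume (r/4)^3. Off the centre, |f| grows by at most sigma r times the l1 norm of its gradient,
    of which the mean square over the corner controls r/4 times. *)
Definition mass_const : R := 512 * sigma ^+ 3 * (1 + 4 * sigma) ^+ 2.

Lemma mass_const_ge0 : 0 <= mass_const.
Proof. by rewrite !mulr_ge0 ?exprn_ge0 ?addr_ge0 ?mulr_ge0 ?ltW ?sigma_gt0. Qed.

Lemma pointwise_le_mass f x : affine f -> elt t x ->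
  volume (elt t) * f x ^+ 2 <= mass_const * integral3 (elt t) (fun x => f x * f x).
Proof.
move=> [a [b fE]] tx; have r2 : 0 < r / 2 by rewrite divr_gt0.
have := integral3_affine_sqr rE r2 fE cube_elt.
set I := integral3 _ _; set m := _ + _ => mI.
have s0 := sigma_gt0.
have fm : `|f x| <= (1 + 4 * sigma) * m.
  have B0 : 0 <= \sum_i `|b 0 i| by apply: sumr_ge0.
  have -> : f x = f c + dotv b (x - c) by rewrite !fE dotvBr; ring.
  apply: (@le_trans _ _ (`|f c| + sigma * r * \sum_i `|b 0 i|)).
    rewrite (le_trans (ler_normD _ _))// lerD2l.
    rewrite (le_trans (ler_norm_sum _ _ _))// mulr_sumr; apply: ler_sum => i _.
    rewrite normrM mulrC ler_wpM2r// (le_trans (coord_le_enorm _ _))//.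
    by rewrite (le_trans _ diam_le)// elt_diam_ge//; exact: elt_center.
  rewrite /m; have := normr_ge0 (f c); move: `|f c| (\sum_i _) B0 => u w w0 u0.
  have : 0 <= sigma * r * w by rewrite !mulr_ge0// ltW.
  have : 0 <= r * w by rewrite mulr_ge0// ltW.
  have : 0 <= sigma * u by rewrite mulr_ge0// ltW.
  lra.
have m0 : 0 <= m by rewrite addr_ge0// mulr_ge0 ?sumr_ge0// ltW// divr_gt0.
have fm2 : f x ^+ 2 <= ((1 + 4 * sigma) * m) ^+ 2.
  rewrite -[f x ^+ 2]real_normK ?num_real// ler_pXn2r ?nnegrE//.
  by rewrite mulr_ge0// addr_ge0// mulr_ge0// ltW.
have vol : volume (elt t) <= 8 * (sigma * r) ^+ 3.
  apply: (le_trans volume_elt_le); rewrite ler_wpM2l//.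
  by rewrite ler_pXn2r ?nnegrE ?(ltW diam_gt0) ?mulr_ge0 ?(ltW s0) ?(ltW r_gt0).
apply: (@le_trans _ _ (8 * (sigma * r) ^+ 3 * ((1 + 4 * sigma) * m) ^+ 2)).
  by rewrite ler_pM// ?volume_ge0 ?sqr_ge0.
rewrite /mass_const; apply: (le_trans _ (ler_wpM2l mass_const_ge0 mI)).
by rewrite /mass_const le_eqVlt; apply/orP; left; apply/eqP; field.
Qed.

Lemma volume_elt_gt0 : 0 < volume (elt t).
Proof.
have r2 : 0 < r / 2 by rewrite divr_gt0.
have fE (x : 'rV[R]_3) : 1 = 1 + dotv 0 x by rewrite dotv0l addr0.
have := @integral3_affine_sqr _ _ (fun=> 1) _ _ _ _ rE r2 fE cube_elt.
rewrite (_ : integral3 _ _ = volume (elt t)); last first.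
  by congr integral3; apply/funext => x; rewrite mulr1.
apply: lt_le_trans; rewrite mulr_gt0 ?exprn_gt0 ?divr_gt0// normr1 ltr_wpDr//.
by rewrite mulr_ge0 ?sumr_ge0// ltW// divr_gt0.
Qed.

End Shape.
End Connected.

(** * Element estimates *)

Section Element.
Context {R : realType}.
Variables (Om : set 'rV[R]_3) (M : mesh R).
Local Notation V := 'I_(nvert M).
Local Notation T := 'I_(ntet M).
Local Notation vt := (@vert R M).
Hypothesis triM : triangulates Om M.
Variables (sigma H : R) (t : T).
Hypothesis H_ge0 : 0 <= H.
Hypothesis diamH : forall x y : 'rV[R]_3, elt t x -> elt t y -> enorm (x - y) <= H.
Variables (c : 'rV[R]_3) (r : R).
Hypothesis r_gt0 : 0 < r.
Hypothesis ball_elt : forall x : 'rV[R]_3, enorm (x - c) <= r -> elt t x.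
Hypothesis diam_le : elt_diam t <= sigma * r.

Local Notation h := (elt_diam t).
Local Notation vol := (volume (elt t)).
Local Notation Cm := (mass_const sigma).

Let tinj := tet_injP triM.
Let tfree := tet_freeP triM.
Let rE : region (elt t) := region_elt (@tinj t) (@tfree t).
Let r0 : 0 <= r := ltW r_gt0.
Let s0 : 0 <= sigma := ltW (sigma_gt0 diamH r_gt0 ball_elt diam_le).
Let h_gt0 : 0 < h := diam_gt0 diamH r_gt0 ball_elt.
Let h0 : 0 <= h := ltW h_gt0.
Let vol0 : 0 <= vol := volume_ge0 (elt t).
Let Cm0 : 0 <= Cm := mass_const_ge0 diamH r_gt0 ball_elt diam_le.
Let center : elt t c := elt_center r_gt0 ball_elt.

Definition normsq (v : 'rV[R]_3 -> 'rV[R]_3) : R :=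
  integral3 (elt t) (fun x => dotv (v x) (v x)).

Lemma normsq_ge0 v : 0 <= normsq v.
Proof. by apply: integral3_ge0 => x _; exact: dotvv_ge0. Qed.

Lemma le_normsq_cst v a : tamev v ->
  (forall x, elt t x -> dotv (v x) (v x) <= a) -> normsq v <= a * vol.
Proof.
move=> tv va; rewrite -integral3_cst//; apply: le_integral3 => //.
- exact: tame_dotv.
- exact: tame_cst.
Qed.

Lemma normsq_cst a : normsq (fun=> a) = dotv a a * vol.
Proof. exact: integral3_cst. Qed.

Lemma pointwise_le_normsq v x : affinev v -> elt t x ->
  vol * dotv (v x) (v x) <= Cm * normsq v.
Proof.
move=> av tx; rewrite /normsq /dotv integral3_sum//; last first.
  by move=> i; apply: tameM; exact: tame_affine.
rewrite !mulr_sumr; apply: ler_sum => i _; rewrite -expr2.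
exact: (pointwise_le_mass triM diamH r_gt0 ball_elt diam_le (av i) tx).
Qed.

Lemma diam_sqr_le x y : elt t x -> elt t y -> dotv (x - y) (x - y) <= h ^+ 2.
Proof.
move=> tx ty; rewrite -sqr_enorm ler_pXn2r ?nnegrE ?enorm_ge0//.
exact: (elt_diam_ge diamH tx ty).
Qed.

(** Cauchy-Schwarz together with |a + b|^2 <= 2 (|a|^2 + |b|^2). *)
Lemma mean_dotv_sqr_le (a b d : 'rV[R]_3) :
  (dotv (a + b) d / 2) ^+ 2 <= (dotv a a + dotv b b) / 2 * dotv d d.
Proof.
have := dotv_sqr_le (a + b) d; have := dotvv_ge0 (a - b).
rewrite !(dotvBl, dotvBr, dotvDl, dotvDr) (dotvC b a).
move: (dotv a d) (dotv b d) (dotv a a) (dotv b b) (dotv a b) => ad bd aa bb ab.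
have := dotvv_ge0 d; move: (dotv d d) => dd dd0 ab0 le.
have := mulr_ge0 dd0 ab0; nra.
Qed.

Lemma edof_sqr_le ij (v : vfield M) m : tedge t ij ->
  dotv (v t (vt ij.1)) (v t (vt ij.1)) <= m ->
  dotv (v t (vt ij.2)) (v t (vt ij.2)) <= m ->
  edof t ij v ^+ 2 <= m * h ^+ 2.
Proof.
move=> /and3P[_ it jt] m1 m2; apply: (le_trans (mean_dotv_sqr_le _ _ _)).
apply: ler_pM; rewrite ?dotvv_ge0//.
- by rewrite divr_ge0// addr_ge0// dotvv_ge0.
- lra.
- by apply: diam_sqr_le; apply: elt_vert.
Qed.

Lemma edof_le_normsq ij (v : vfield M) : tedge t ij -> affinev (v t) ->
  vol * edof t ij v ^+ 2 <= Cm * normsq (v t) * h ^+ 2.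
Proof.
move=> tij av; have /and3P[_ it jt] := tij.
have vol_gt0 := volume_elt_gt0 triM r_gt0 ball_elt.
rewrite -ler_pdivlMl// [leRHS]mulrA; apply: edof_sqr_le => //;
  rewrite ler_pdivlMl//; apply: pointwise_le_normsq => //; exact: elt_vert.
Qed.

Let w (ij : V * V) := wform (@lam R M ij.1 t) (lam ij.2 t).

Let aw ij : affinev (w ij).
Proof. by apply: affinev_wform; exact: affine_lam. Qed.

Let grad_le i x : dotv (gradf (@lam R M i t) x) (gradf (lam i t) x) * r ^+ 2 <= 1.
Proof.
by rewrite (gradf_cst x 0 (affine_lam t i)); exact: (gradf_lam_le triM r_gt0 ball_elt i).
Qed.

Lemma wform_sqr_le ij x : elt t x -> dotv (w ij x) (w ij x) * r ^+ 2 <= 4.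
Proof.
move=> tx; rewrite /w /wform.
have := grad_le ij.1 x; have := grad_le ij.2 x.
move: (gradf _ _) (gradf _ _) => b a.
have /(eltP (@tinj t) (@tfree t)) l0 := tx.
have := lam_le1 (@tinj t) (@tfree t) ij.1 tx; have := lam_le1 (@tinj t) (@tfree t) ij.2 tx.
have := l0 ij.1; have := l0 ij.2.
move: (lam _ _ _) (lam _ _ _) => q p q0 p0 q1 p1.
have := dotvv_ge0 (p *: b + q *: a).
rewrite !(dotvBl, dotvBr, dotvDl, dotvDr, dotvZl, dotvZr) (dotvC a b).
have := dotvv_ge0 a; have := dotvv_ge0 b; have := sqr_ge0 r.
move: (dotv a a) (dotv b b) (dotv b a) (r ^+ 2) => aa bb ab rr rr0 bb0 aa0 h1 h2 h3.
have p2 : p * p <= 1 by rewrite mulr_ile1.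
have q2 : q * q <= 1 by rewrite mulr_ile1.
have : p * p * (bb * rr) <= 1 by rewrite mulr_ile1// ?mulr_ge0.
have : q * q * (aa * rr) <= 1 by rewrite mulr_ile1// ?mulr_ge0.
nra.
Qed.

Lemma curl_wform_sqr_le ij x :
  dotv (curlf (w ij) x) (curlf (w ij) x) * r ^+ 4 <= 4.
Proof.
rewrite curlf_wform; [|exact: affine_lam|exact: affine_lam].
have := grad_le ij.1 x; have := grad_le ij.2 x.
have := crossv_sqr_le (gradf (lam ij.1 t) x) (gradf (lam ij.2 t) x).
rewrite dotvZl dotvZr; move: (gradf _ _) (gradf _ _) => b a.
have := dotvv_ge0 a; have := dotvv_ge0 b; have := sqr_ge0 r.
have -> : r ^+ 4 = r ^+ 2 * r ^+ 2 by ring.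
move: (dotv (crossv _ _) _) (dotv a a) (dotv b b) (r ^+ 2).
move=> k aa bb rr rr0 bb0 aa0 kab ar br.
have : aa * rr * (bb * rr) <= 1 by rewrite mulr_ile1 ?mulr_ge0.
have rr2 := mulr_ge0 rr0 rr0; have := ler_wpM2r rr2 kab.
nra.
Qed.

Lemma tame_curl (v : 'rV[R]_3 -> 'rV[R]_3) : affinev v -> tamev (curlf v).
Proof.
move=> av i; rewrite (_ : (fun x => _) = fun=> curlf v 0 0 i); first exact: tame_cst.
by apply/funext => x; rewrite (curlf_cst x 0 av).
Qed.

Lemma normsq_wform ij : normsq (w ij) * r ^+ 2 <= 4 * vol.
Proof.
rewrite -ler_pdivlMr ?exprn_gt0// mulrAC; apply: le_normsq_cst.
  exact: tame_affinev.
by move=> x tx; rewrite ler_pdivlMr ?exprn_gt0//; exact: wform_sqr_le.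
Qed.

Lemma normsq_curl_wform ij : normsq (curlf (w ij)) * r ^+ 4 <= 4 * vol.
Proof.
rewrite -ler_pdivlMr ?exprn_gt0// mulrAC; apply: le_normsq_cst.
  exact: tame_curl.
by move=> x tx; rewrite ler_pdivlMr ?exprn_gt0//; exact: curl_wform_sqr_le.
Qed.

Definition diag_const : R := 4 * (1 + H ^+ 2) * Cm * sigma ^+ 4.

(** The squared degree of freedom is at most Cm h^2 |v|^2 / vol. The curl energy of the basis
    function is at most 4 vol / r^4 and its mass at most 4 vol / r^2, where r <= H raises the latter
    to order r^-4. Volumes cancel, and h <= sigma r leaves h^-2. *)
Lemma diag_le eps ij (v : vfield M) : 0 <= eps <= 1 -> tedge t ij -> affinev (v t) ->
  edof t ij v ^+ 2 * (normsq (curlf (w ij)) + eps * normsq (w ij))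
    <= diag_const * (h^-1 ^+ 2 * normsq (v t)).
Proof.
move=> /andP[e0 e1] tij av.
have hH : h <= H := elt_diam_le diamH r_gt0 ball_elt.
have rh : r <= h := radius_le_diam diamH r_gt0 ball_elt.
have := edof_le_normsq tij av; have := normsq_wform ij; have := normsq_curl_wform ij.
have := normsq_ge0 (curlf (w ij)); have := normsq_ge0 (w ij); have := normsq_ge0 (v t).
have := sqr_ge0 (edof t ij v).
move: (normsq (v t)) (normsq (w ij)) (normsq (curlf (w ij))) (edof t ij v ^+ 2).
move=> N B A E E0 N0 B0 A0 Ar Br EN.
have r2 : r ^+ 2 <= H ^+ 2 by rewrite ler_pXn2r ?nnegrE// (le_trans rh).
have X : (A + eps * B) * r ^+ 4 <= 4 * (1 + H ^+ 2) * vol.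
  have : eps * (B * r ^+ 2) <= 4 * vol by rewrite -[leRHS]mul1r ler_pM// mulr_ge0// sqr_ge0.
  move: Ar; have -> : r ^+ 4 = r ^+ 2 * r ^+ 2 by ring.
  have := sqr_ge0 r; move: (r ^+ 2) r2 => rr r2 rr0 Ar2 eB.
  have := ler_wpM2r rr0 eB; have := ler_wpM2l vol0 r2.
  lra.
set Y := A + eps * B in X *.
have Y0 : 0 <= Y by rewrite addr_ge0// mulr_ge0.
have h4 : h ^+ 4 <= sigma ^+ 4 * r ^+ 4.
  by rewrite -exprMn ler_pXn2r ?nnegrE ?mulr_ge0.
have E1 : E * Y * r ^+ 4 <= 4 * (1 + H ^+ 2) * (Cm * N * h ^+ 2).
  apply: (@le_trans _ _ (4 * (1 + H ^+ 2) * (vol * E))).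
    by rewrite -mulrA mulrC [leRHS]mulrA; apply: ler_wpM2r.
  by apply: ler_wpM2l => //; rewrite mulr_ge0// addr_ge0// sqr_ge0.
have E2 : E * Y * h ^+ 4 <= sigma ^+ 4 * (4 * (1 + H ^+ 2) * (Cm * N * h ^+ 2)).
  apply: (@le_trans _ _ (E * Y * (sigma ^+ 4 * r ^+ 4))).
    by apply: ler_wpM2l => //; rewrite mulr_ge0.
  by rewrite mulrCA; apply: ler_wpM2l => //; rewrite exprn_ge0.
rewrite -(@ler_pM2r _ (h ^+ 4)) ?exprn_gt0//; apply: (le_trans E2).
rewrite le_eqVlt; apply/orP; left; apply/eqP; rewrite /diag_const.
by field; rewrite gt_eqF.
Qed.

Let G (v : vfield M) ij := edof t ij v.
Let interp (v : vfield M) x := \sum_(ij : V * V | tedge t ij) G v ij *: w ij x.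

Lemma interp_le (v : vfield M) : affinev (v t) ->
  normsq (interp v) <= 1024 * sigma ^+ 2 * Cm * normsq (v t).
Proof.
move=> av; have hs : h ^+ 2 <= sigma ^+ 2 * r ^+ 2.
  by rewrite -exprMn ler_pXn2r ?nnegrE ?mulr_ge0.
have tw ij : tamev (w ij) by exact: tame_affinev.
have vol_gt0 := volume_elt_gt0 triM r_gt0 ball_elt.
set N := normsq (v t); have N0 : 0 <= N := normsq_ge0 _.
have G2 ij : tedge t ij -> G v ij ^+ 2 <= Cm * N * h ^+ 2 / vol.
  by move=> tij; rewrite ler_pdivlMr// mulrC; exact: edof_le_normsq.
rewrite -(@ler_pM2r _ (r ^+ 2)) ?exprn_gt0//.
rewrite -ler_pdivlMr ?exprn_gt0//.
(* One 16 comes from squaring a sum, one from counting its terms; with the 4 of [wform_sqr_le] they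
   make 1024. *)
pose a := 16 * (16 * (Cm * N * h ^+ 2 / vol * (4 / r ^+ 2))).
apply: (@le_trans _ _ (a * vol)).
  apply: le_normsq_cst.
    apply: tame_affinev.
    by have [] := affinev_lincomb (index_enum (V * V)%type) (tedge t) (G v) aw.
  move=> x tx; apply: (le_trans (dotv_sum_sqr_le _ _)).
  have b0 : 0 <= Cm * N * h ^+ 2 / vol * (4 / r ^+ 2).
    apply: mulr_ge0; apply: divr_ge0 => //; last exact: exprn_ge0.
    exact: mulr_ge0 (mulr_ge0 Cm0 N0) (exprn_ge0 2 h0).
  apply: ler_pM => //; first by apply: sumr_ge0 => ij _; exact: dotvv_ge0.
    by rewrite ler_nat (card_tedge triM).
  apply: (@le_trans _ _ (\sum_(ij : V * V | tedge t ij)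
      Cm * N * h ^+ 2 / vol * (4 / r ^+ 2))).
    apply: ler_sum => ij tij; rewrite dotvZl dotvZr mulrA -expr2.
    apply: ler_pM; rewrite ?sqr_ge0 ?dotvv_ge0//; first exact: G2.
    by rewrite ler_pdivlMr ?exprn_gt0//; exact: wform_sqr_le.
  rewrite sumr_const -[leLHS]mulr_natl; apply: ler_wpM2r => //.
  by rewrite ler_nat (card_tedge triM).
rewrite ler_pdivlMr ?exprn_gt0// /a.
rewrite (_ : _ * vol * r ^+ 2 = 1024 * (Cm * N) * h ^+ 2); last first.
  by field; rewrite !gt_eqF.
apply: (@le_trans _ _ (1024 * (Cm * N) * (sigma ^+ 2 * r ^+ 2))).
  by apply: ler_wpM2l hs; exact: mulr_ge0 (ler0n _ _) (mulr_ge0 Cm0 N0).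
rewrite le_eqVlt; apply/orP; left; apply/eqP; ring.
Qed.

(* Subtracting the value a = v c does not change the curl of the interpolant,
   since constant fields are gradients and are reproduced. *)
Lemma curl_interp_le (v : vfield M) : affinev (v t) ->
  normsq (curlf (interp v)) <=
    1024 * sigma ^+ 4 * \sum_k normsq (gradf (fun x => v t x 0 k)).
Proof.
move=> av; pose g k := gradf (fun x => v t x 0 k) 0.
have gE : \sum_k normsq (gradf (fun x => v t x 0 k)) = (\sum_k dotv (g k) (g k)) * vol.
  rewrite mulr_suml; apply: eq_bigr => k _; rewrite -normsq_cst.
  by congr normsq; apply/funext => x; exact: gradf_cst.
set S := \sum_k dotv (g k) (g k) in gE.
have S0 : 0 <= S by apply: sumr_ge0 => k _; exact: dotvv_ge0.
pose a := v t c.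
pose u : vfield M := fun t x => v t x - a.
pose f := fun x => dotv a x.
have af : affine f by exists 0, a => x; rewrite add0r.
have fa x : gradf f x = a by apply: (@gradf_affine _ _ 0) => y; rewrite add0r.
have aG : affinev (interp v).
  by have [] := affinev_lincomb (index_enum (V * V)%type) (tedge t) (G v) aw.
have cE x : curlf (interp v) x = \sum_(ij : V * V | tedge t ij) G u ij *: curlf (w ij) x.
  have [_ ->] := affinev_lincomb (index_enum (V * V)%type) (tedge t) (G v) aw.
  have [_ c0] := affinev_lincomb (index_enum (V * V)%type) (tedge t)
    (fun ij => f (vt ij.2) - f (vt ij.1)) aw.
  transitivity (\sum_(ij : V * V | tedge t ij) G u ij *: curlf (w ij) x +
      \sum_(ij : V * V | tedge t ij) (f (vt ij.2) - f (vt ij.1)) *: curlf (w ij) x).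
    rewrite -big_split /=; apply: eq_bigr => ij _; rewrite -scalerDl; congr (_ *: _).
    by rewrite /G /edof /u /f !(dotvBl, dotvBr, dotvDl); field.
  rewrite -c0 (_ : (fun x => _) = fun=> a); last first.
    apply/funext => y; rewrite -[RHS](fa y).
    exact: (sum_wform_grad triM).
  rewrite -[RHS]addr0; congr (_ + _); apply/rowP => k; rewrite curlfE.
  have gc (q : R) : gradf (fun=> q) x = 0.
    by apply: (@gradf_affine _ _ q) => y; rewrite dotv0l addr0.
  by rewrite !gc !mxE subrr.
have uS x : elt t x -> dotv (u t x) (u t x) <= S * h ^+ 2.
  move=> tx; rewrite /dotv mulr_suml; apply: ler_sum => k _.
  rewrite /u !mxE (affine_diff x c 0 (av k)) -expr2.
  apply: (le_trans (dotv_sqr_le _ _)); apply: ler_wpM2l; first exact: dotvv_ge0.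
  exact: diam_sqr_le.
(* One factor h^2 is from the variation of v about a, the other from the edge length; they balance
   the r^-4 of the curls. *)
have G2 ij : tedge t ij -> G u ij ^+ 2 <= S * h ^+ 4.
  move=> tij; have /and3P[_ it jt] := tij.
  rewrite (_ : S * h ^+ 4 = S * h ^+ 2 * h ^+ 2); last by ring.
  by apply: edof_sqr_le => //; apply: uS; apply: elt_vert.
have hs : h ^+ 4 <= sigma ^+ 4 * r ^+ 4.
  by rewrite -exprMn ler_pXn2r ?nnegrE ?mulr_ge0.
rewrite gE mulrA; apply: le_normsq_cst; first exact: tame_curl.
move=> x tx; rewrite cE; apply: (le_trans (dotv_sum_sqr_le _ _)).
have b0 : 0 <= S * h ^+ 4 * (4 / r ^+ 4).
  by apply: mulr_ge0; [apply: mulr_ge0|apply: divr_ge0] => //; exact: exprn_ge0.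
apply: (@le_trans _ _ (16 * (16 * (S * h ^+ 4 * (4 / r ^+ 4))))).
  apply: ler_pM => //; first by apply: sumr_ge0 => ij _; exact: dotvv_ge0.
    by rewrite ler_nat (card_tedge triM).
  apply: (@le_trans _ _ (\sum_(ij : V * V | tedge t ij) S * h ^+ 4 * (4 / r ^+ 4))).
    apply: ler_sum => ij tij; rewrite dotvZl dotvZr mulrA -expr2.
    apply: ler_pM; rewrite ?sqr_ge0 ?dotvv_ge0//; first exact: G2.
    by rewrite ler_pdivlMr ?exprn_gt0//; exact: curl_wform_sqr_le.
  rewrite sumr_const -[leLHS]mulr_natl; apply: ler_wpM2r => //.
  by rewrite ler_nat (card_tedge triM).
rewrite (_ : 16 * _ = 1024 * S * (h ^+ 4 / r ^+ 4)); last by field; rewrite gt_eqF.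
have hr : h ^+ 4 / r ^+ 4 <= sigma ^+ 4 by rewrite ler_pdivrMr ?exprn_gt0.
rewrite [leRHS]mulrAC; exact: (ler_wpM2l (mulr_ge0 (ler0n _ _) S0) hr).
Qed.

End Element.

(** * Global estimates *)

Section Global.
Context {R : realType}.
Variables (Om : set 'rV[R]_3) (M : mesh R).
Local Notation V := 'I_(nvert M).
Local Notation T := 'I_(ntet M).
Local Notation vt := (@vert R M).
Local Notation ivert := (ivert Om M).
Local Notation iedge := (iedge Om M).
Hypothesis opOm : open Om.
Hypothesis triM : triangulates Om M.
Variables (sigma H : R).
Hypothesis H_ge0 : 0 <= H.
Hypothesis diamH : forall (t : T) (x y : 'rV[R]_3), elt t x -> elt t y ->
  enorm (x - y) <= H.
Hypothesis shape : forall t : T, exists (c : 'rV[R]_3) (r : R),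
  [/\ 0 < r, forall x, enorm (x - c) <= r -> elt t x & elt_diam t <= sigma * r].
Variable eps : R.
Hypothesis eps01 : 0 <= eps <= 1.

Let tinj := tet_injP triM.
Let tfree := tet_freeP triM.
Let rE (t : T) : region (elt t) := region_elt (@tinj t) (@tfree t).
Let eps0 : 0 <= eps. Proof. by case/andP: eps01. Qed.

Let vol_gt0 (t : T) : 0 < volume (elt t).
Proof. by have [c [r [r0 rc _]]] := shape t; exact: (volume_elt_gt0 triM r0 rc). Qed.

Lemma vL2_normsq (v : vfield M) : vL2 v v = \sum_t normsq t (v t).
Proof. by []. Qed.

Lemma card_iedge (t : T) : (#|(fun e : iedge => tedge t (val e))| <= 16)%N.
Proof.
apply: leq_trans (card_tedge triM t).
set P := fun e : iedge => _.
have <- : #|[seq val e | e in P]| = #|P| by apply: card_in_image => e e' _ _; exact: val_inj.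
by apply: subset_leq_card; apply/fintype.subsetP => _ /fintype.imageP[e te ->].
Qed.

(** At most 16 of the F e are nonzero on t, so squaring the sum costs a factor 16. Used for the
    Whitney functions and for their curls. *)
Lemma overlap (t : T) (F : iedge -> 'rV[R]_3 -> 'rV[R]_3) (u : iedge -> R) :
  (forall e, tamev (F e)) -> (forall e x, ~~ tedge t (val e) -> F e x = 0) ->
  normsq t (fun x => \sum_e u e *: F e x) <= 16 * \sum_e u e ^+ 2 * normsq t (F e).
Proof.
move=> tF F0.
have tFF e : tame (fun x => u e ^+ 2 * dotv (F e x) (F e x)).
  by apply: tameM; [exact: tame_cst|exact: tame_dotv].
have -> : \sum_e u e ^+ 2 * normsq t (F e) =
    integral3 (elt t) (fun x => \sum_e u e ^+ 2 * dotv (F e x) (F e x)).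
  rewrite integral3_sum//; apply: eq_bigr => e _.
  by rewrite integral3Z//; exact: tame_dotv.
have tS : tame (fun x => \sum_e u e ^+ 2 * dotv (F e x) (F e x)) by exact: tame_sum.
have tuF : tamev (fun x => \sum_e u e *: F e x).
  move=> i; rewrite (_ : (fun x => _) = fun x => \sum_e u e * F e x 0 i).
    by apply: tame_sum => e; apply: tameM; [exact: tame_cst|exact: tF].
  by apply/funext => x; rewrite summxE; apply: eq_bigr => e _; rewrite mxE.
rewrite -integral3Z//; apply: le_integral3 => //; first exact: tame_dotv.
  exact: (tameM (tame_cst 16) tS).
move=> x tx; rewrite (bigID (fun e : iedge => tedge t (val e))) /=.
rewrite [X in _ + X]big1 ?addr0; last by move=> e h; rewrite F0// scaler0.
apply: (le_trans (dotv_sum_sqr_le _ _)); apply: ler_pM => //.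
- by apply: sumr_ge0 => e _; exact: dotvv_ge0.
- by rewrite ler_nat card_iedge.
rewrite [leRHS](bigID (fun e : iedge => tedge t (val e))) /= -[leLHS]addr0.
apply: lerD; last first.
  by apply: sumr_ge0 => e _; rewrite mulr_ge0 ?sqr_ge0 ?dotvv_ge0.
by apply: ler_sum => e _; rewrite dotvZl dotvZr mulrA -expr2.
Qed.

Lemma curl_efield (u : iedge -> R) (t : T) : @curl R M (efield u) t =
  fun x => \sum_e u e *: @curl R M (whitney e) t x.
Proof.
apply/funext => x; have [_ h] := affinev_lincomb (index_enum iedge) predT u
  (fun e => @affinev_whitney _ _ _ e t).
exact: h.
Qed.

Lemma curl_whitney0 (t : T) (e : iedge) x : ~~ tedge t (val e) ->
  @curl R M (whitney e) t x = 0.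
Proof.
move=> te; rewrite /curl (_ : whitney e t = fun=> 0).
  have gc (q : R) : gradf (fun=> q) x = 0.
    by apply: (@gradf_affine _ _ q) => y; rewrite dotv0l addr0.
  apply/rowP => k; rewrite curlfE.
  have z i : (fun y : 'rV[R]_3 => (0 : 'rV[R]_3) 0 i) = fun=> 0.
    by apply/funext => y; rewrite mxE.
  by rewrite !z !gc !mxE subrr.
by apply/funext => y; exact: whitney0.
Qed.

(** The diagonal entry of [A_curl] at e, hence the entry of [D_curl]. *)
Let acurl (e : iedge) : R :=
  vL2 (@curl R M (whitney e)) (@curl R M (whitney e)) + eps * vL2 (whitney e) (whitney e).

Lemma A_curl_le_diag x :
  bform (A_curl Om M eps) x x <= 16 * \sum_e coef x e ^+ 2 * acurl e.
Proof.
rewrite (bform_curl triM).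
have aw e t := @affinev_whitney _ Om M e t.
have h1 : vL2 (@curl R M (efield (coef x))) (@curl R M (efield (coef x))) <=
    16 * \sum_e coef x e ^+ 2 * vL2 (@curl R M (whitney e)) (@curl R M (whitney e)).
  under [in leRHS]eq_bigr do rewrite vL2_normsq mulr_sumr.
  rewrite exchange_big mulr_sumr vL2_normsq; apply: ler_sum => t _.
  rewrite curl_efield; apply: overlap => [e|e y]; first exact: tame_curl.
  exact: curl_whitney0.
have h2 : vL2 (efield (coef x)) (efield (coef x)) <=
    16 * \sum_e coef x e ^+ 2 * vL2 (@whitney R Om M e) (whitney e).
  under [in leRHS]eq_bigr do rewrite vL2_normsq mulr_sumr.
  rewrite exchange_big mulr_sumr vL2_normsq; apply: ler_sum => t _.
  apply: overlap => [e|e y]; first exact: tame_affinev.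
  exact: whitney0.
apply: (le_trans (lerD h1 (ler_wpM2l eps0 h2))).
rewrite mulrCA -mulrDr ler_wpM2l// mulr_sumr -big_split /= le_eqVlt.
by apply/orP; left; apply/eqP; apply: eq_bigr => e _; rewrite /acurl; ring.
Qed.

Lemma normsq_ge0T (t : T) v : 0 <= normsq t v.
Proof. by apply: integral3_ge0 => x _; exact: dotvv_ge0. Qed.

Lemma dof_diag_le (v : vfield M) : Hcurl Om v ->
  \sum_e dof e v ^+ 2 * acurl e <= 16 * `|diag_const sigma H| * hinv_normsq v.
Proof.
move=> vH; have av := affinev_Hcurl vH.
pose loc t (e : iedge) := normsq t (@curl R M (whitney e) t) + eps * normsq t (whitney e t).
have aE e : acurl e = \sum_t loc t e by rewrite big_split /= -mulr_sumr.
have hE : hinv_normsq v = \sum_t (elt_diam t)^-1 ^+ 2 * normsq t (v t).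
  apply: eq_bigr => t _; rewrite -integral3Z//; last first.
    by apply: tame_dotv; exact: tame_affinev.
  by congr integral3; apply/funext => x; rewrite dotvZl dotvZr mulrA -expr2.
under eq_bigr do rewrite aE mulr_sumr.
rewrite exchange_big hE mulr_sumr; apply: ler_sum => t _.
set b := _ ^+ 2 * _; have b0 : 0 <= b by rewrite mulr_ge0 ?sqr_ge0 ?normsq_ge0T.
rewrite (bigID (fun e : iedge => tedge t (val e))) /= [X in _ + X]big1; last first.
  move=> e te; rewrite /loc (_ : curl _ _ = fun=> 0); last first.
    by apply/funext => x; exact: curl_whitney0.
  rewrite (_ : whitney e t = fun=> 0); last by apply/funext => x; exact: whitney0.
  rewrite /normsq; under eq_fun do rewrite dotv0l.
  by rewrite integral3_cst// mul0r mulr0 addr0 mulr0.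
rewrite addr0; apply: (@le_trans _ _
  (\sum_(e : iedge | tedge t (val e)) `|diag_const sigma H| * b)).
  apply: ler_sum => e te; rewrite (dof_tedge triM vH te).
  have [c [r [r0 rc dr]]] := shape t.
  apply: (le_trans (diag_le triM H_ge0 (@diamH t) r0 rc dr eps01 te (av t))).
  by rewrite -/b ler_wpM2r// ler_norm.
rewrite sumr_const -[leLHS]mulr_natl -[leRHS]mulrA; apply: ler_wpM2r.
  exact: mulr_ge0 (normr_ge0 _) b0.
by rewrite ler_nat card_iedge.
Qed.

(** The sign of sigma is known only once a tetrahedron is given; the absolute value makes the
    constant nonnegative outright, and the added 1 makes it positive, as [correction_upper]
    requires. *)
Definition interp_const : R :=
  1024 * `|sigma ^+ 2 * mass_const sigma| + 1024 * sigma ^+ 4 + 1.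

Lemma interp_energy_le (v : vfield M) : Hgrad3 Om v ->
  vL2 (@curl R M (Pi_curl Om v)) (@curl R M (Pi_curl Om v))
    + eps * vL2 (Pi_curl Om v) (Pi_curl Om v)
    <= interp_const * (grad3L2 v v + eps * vL2 v v).
Proof.
move=> vH; set E := Pi_curl Om v; have av := affinev_Hgrad3 vH.
have EE t : E t = fun x => \sum_(ij : V * V | tedge t ij)
    edof t ij v *: wform (lam ij.1 t) (lam ij.2 t) x.
  apply: efield_local => [e te|ij tij sb]; first exact: (Hgrad3_dof_tedge triM vH te).
  exact: (Hgrad3_edof_bdry triM vH tij sb).
have h1 : vL2 (@curl R M E) (@curl R M E) <= 1024 * sigma ^+ 4 * grad3L2 v v.
  rewrite /grad3L2; under [in leRHS]eq_bigr do rewrite vL2_normsq.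
  rewrite exchange_big mulr_sumr vL2_normsq; apply: ler_sum => t _.
  have [c [r [r0 rc dr]]] := shape t.
  by rewrite /curl EE; exact: (curl_interp_le triM (@diamH t) r0 rc dr (av t)).
have h2 : vL2 E E <= 1024 * `|sigma ^+ 2 * mass_const sigma| * vL2 v v.
  rewrite !vL2_normsq mulr_sumr; apply: ler_sum => t _.
  have [c [r [r0 rc dr]]] := shape t.
  rewrite EE; apply: (le_trans (interp_le triM (@diamH t) r0 rc dr (av t))).
  apply: ler_wpM2r; first exact: normsq_ge0T.
  by rewrite -mulrA; exact: (ler_wpM2l (ler0n R 1024) (ler_norm _)).
have g0 := grad3L2_ge0 v; have v0 := vL2_ge0 v.
have ev0 : 0 <= eps * vL2 v v by rewrite mulr_ge0.
apply: (le_trans (lerD h1 (ler_wpM2l eps0 h2))).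
have k0 : 0 <= 1024 * sigma ^+ 4.
  rewrite (_ : sigma ^+ 4 = (sigma ^+ 2) ^+ 2); last by ring.
  exact: (mulr_ge0 (ler0n R 1024) (sqr_ge0 _)).
have := normr_ge0 (sigma ^+ 2 * mass_const sigma).
rewrite /interp_const; move: `|_| (1024 * sigma ^+ 4) k0 => a b b0 a0.
rewrite mulrCA -subr_ge0.
move: (eps * vL2 v v) (grad3L2 v v) ev0 g0 => x y x0 y0.
rewrite (_ : _ - _ = 1024 * a * y + y + (b * x + x)); last by ring.
have k1 : 0 <= 1024 * a := mulr_ge0 (ler0n R 1024) a0.
exact: (addr_ge0 (addr_ge0 (mulr_ge0 k1 y0) y0) (addr_ge0 (mulr_ge0 b0 x0) x0)).
Qed.

Lemma nodal_pfield (c : ivert -> R) : @nodal R Om M (pfield c) = c.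
Proof.
apply/funext => i; have [[_ /(_ (val i))[t it]] _ _ _ _] := triM.
rewrite (nodalE triM (Hgrad_pfield opOm triM c) it) /pfield (bigD1 i)//=.
rewrite big1 ?addr0 => [|j ji]; rewrite /hat (lam_vert (@tinj t) (@tfree t))//.
  by rewrite eqxx mulr1.
by rewrite val_eqE (negPf ji) mulr0.
Qed.

(** Each elementwise gradient is constant and each volume positive, so p is piecewise constant;
    continuity and the boundary values then make it 0. *)
Lemma vL2_grad_eq0 (p : sfield M) : Hgrad Om p ->
  vL2 (@grad R M p) (@grad R M p) = 0 -> @nodal R Om M p = fun=> 0.
Proof.
move=> pH; have [ap _ _] := pH; rewrite vL2_normsq => /eqP.
rewrite psumr_eq0 => [|t _]; last exact: normsq_ge0T.
move=> /allP h.
have g0 t : gradf (p t) 0 = 0.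
  have /implyP/(_ isT)/eqP := h t (mem_index_enum _).
  rewrite (_ : grad p t = fun=> gradf (p t) 0); last first.
    by apply/funext => x; exact: gradf_cst.
  rewrite (normsq_cst triM) => /eqP; rewrite mulf_eq0 (gt_eqF (vol_gt0 t)) orbF.
  by move=> /eqP/dotvv_eq0.
apply/funext => i; rewrite /nodal; case: pickP => [t _|//].
exact: (Hgrad_grad0 opOm triM pH g0).
Qed.

(** The gradient term alone is definite, so eps = 0 is included. *)
Lemma posdef_A_grad : posdef (A_grad Om M eps).
Proof.
split.
  by apply: fmatrix_tr => i j; rewrite vL2C sL2C.
move=> x x0; rewrite (bform_grad triM); set p := pfield (coef x).
have pH : Hgrad Om p := Hgrad_pfield opOm triM _.
have g0 := vL2_ge0 (@grad R M p); have s0 := mulr_ge0 eps0 (sL2_ge0 p).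
rewrite lt_neqAle addr_ge0// andbT eq_sym; apply: contra x0.
rewrite paddr_eq0// => /andP[/eqP/(vL2_grad_eq0 pH)+ _].
rewrite nodal_pfield => cx; apply/eqP/colP => a.
by have /(congr1 (fun f => f (enum_val a))) := cx; rewrite /coef enum_valK mxE.
Qed.

Lemma grad3L2C (v w : vfield M) : grad3L2 v w = grad3L2 w v.
Proof. by apply: eq_bigr => k _; exact: vL2C. Qed.

Lemma posdef_A_grad3 : posdef (A_grad3 Om M eps).
Proof.
split.
  by apply: fmatrix_tr => i j; rewrite grad3L2C vL2C.
move=> x x0; rewrite (bform_grad3 triM); set v := p3field (coef x).
have g0 := grad3L2_ge0 v; have s0 := mulr_ge0 eps0 (vL2_ge0 v).
rewrite lt_neqAle addr_ge0// andbT eq_sym; apply: contra x0.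
rewrite paddr_eq0// => /andP[+ _]; rewrite psumr_eq0 => [|k _]; last exact: vL2_ge0.
move=> /allP h; have cx ik : coef x ik = 0.
  case: ik => i k; have /implyP/(_ isT)/eqP := h k (mem_index_enum _).
  rewrite comp_p3field => /(vL2_grad_eq0 (Hgrad_pfield opOm triM _)).
  by rewrite nodal_pfield => /(congr1 (fun f => f i)).
by apply/eqP/colP => a; have := cx (enum_val a); rewrite /coef enum_valK mxE.
Qed.

(** Positivity comes from the curl term on a tetrahedron containing e, so it holds for eps = 0
    too. *)
Lemma acurl_gt0 e : 0 < acurl e.
Proof.
have e0 := mulr_ge0 eps0 (vL2_ge0 (@whitney R Om M e)); rewrite ltr_wpDr//.
have /and3P[ij /fintype.existsP[t /andP[it jt]] _] := valP e.
rewrite vL2_normsq (bigD1 t)//= ltr_wpDr ?sumr_ge0//.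
  by move=> t' _; exact: normsq_ge0T.
rewrite (_ : curl _ _ = fun=> curlf (whitney e t) 0); last first.
  by apply/funext => x; apply: curlf_cst; exact: affinev_whitney.
rewrite (normsq_cst triM) mulr_gt0// lt_neqAle dotvv_ge0 andbT eq_sym.
apply/negP => /eqP/dotvv_eq0; rewrite whitneyE curlf_wform; try exact: affine_lam.
move=> /eqP; rewrite scaler_eq0 pnatr_eq0 /= => /negPn; rewrite negbK.
have ij' : (val e).1 != (val e).2 by rewrite neq_ltn ij.
by move=> z; have := crossv_gradf_lam_neq0 (@tinj t) (@tfree t) 0 it jt ij'; rewrite z.
Qed.

Lemma bform_D_curl x : bform (D_curl Om M eps) x x = \sum_e coef x e ^+ 2 * acurl e.
Proof.
rewrite bform_sum (big_enum_val (fun e => coef x e ^+ 2 * acurl e)).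
apply: eq_bigr => a _; rewrite (bigD1 a)//= big1 => [|b ba]; last first.
  by rewrite !mxE eq_sym (negPf ba) mulr0.
by rewrite !mxE eqxx addr0 /coef enum_valK expr2.
Qed.

Lemma posdef_D_curl : posdef (D_curl Om M eps).
Proof.
split=> [|x x0]; first by rewrite tr_diag_mx.
have s e : 0 <= coef x e ^+ 2 * acurl e by rewrite mulr_ge0 ?sqr_ge0// ltW ?acurl_gt0.
rewrite bform_D_curl lt_neqAle sumr_ge0// andbT eq_sym; apply: contra x0.
rewrite psumr_eq0// => /allP h; apply/eqP/colP => a; rewrite mxE.
have /implyP/(_ isT) := h (enum_val a) (mem_index_enum _).
rewrite mulf_eq0 (gt_eqF (acurl_gt0 _)) orbF sqrf_eq0 /coef enum_valK.
by move=> /eqP.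
Qed.

End Global.

(** * The Hiptmair-Xu preconditioner *)

Section Preconditioner.
Context {R : realType}.
Variables (Om : set 'rV[R]_3) (M : mesh R).
Local Notation T := 'I_(ntet M).
Local Notation ivert := (ivert Om M).
Local Notation iedge := (iedge Om M).
Hypothesis opOm : open Om.
Hypothesis triM : triangulates Om M.
Variables (sigma H CR : R).
Hypothesis H_ge0 : 0 <= H.
Hypothesis diamH : forall (t : T) (x y : 'rV[R]_3), elt t x -> elt t y ->
  enorm (x - y) <= H.
Hypothesis shape : forall t : T, exists (c : 'rV[R]_3) (r : R),
  [/\ 0 < r, forall x, enorm (x - c) <= r -> elt t x & elt_diam t <= sigma * r].
Hypothesis regdec : regular_decomposition Om M CR.
Variable eps : R.
Hypothesis eps01 : 0 <= eps <= 1.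

Let eps0 : 0 <= eps. Proof. by case/andP: eps01. Qed.
Let eps1 : eps <= 1. Proof. by case/andP: eps01. Qed.

Local Notation A := (A_curl Om M eps).
Local Notation D := (D_curl Om M eps).
Local Notation A3 := (A_grad3 Om M eps).
Local Notation Ag := (A_grad Om M eps).
Local Notation Pi := (Pi_mx Om M).
Local Notation Gr := (grad_mx Om M).

Let ef (u : 'cV[R]_#|{: iedge}|) : vfield M := efield (coef u).


Lemma A_curl_sym : A^T = A.
Proof.
apply: fmatrix_tr => e e'; exact: (f_equal2 (fun a b => a + eps * b)
  (vL2C (curl (whitney e)) (curl (whitney e'))) (vL2C (whitney e) (whitney e'))).
Qed.

Lemma A_curl_ge0 u : 0 <= bform A u u.
Proof. by rewrite (bform_curl triM) addr_ge0 ?mulr_ge0 ?vL2_ge0. Qed.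

Lemma coef_grad_mx (z : 'cV[R]_#|{: ivert}|) :
  coef (Gr *m z) = fun e => dof e (@grad R M (pfield (coef z))).
Proof.
have ah i t := @affine_hat _ Om M i t.
apply/funext => e; rewrite coef_mul /pfield grad_lincomb// dof_lincomb//.
by move=> i t; exact: affinev_grad.
Qed.

Lemma coef_Pi_mx (z : 'cV[R]_#|{: ivert * 'I_3}|) :
  coef (Pi *m z) = fun e => dof e (p3field (coef z)).
Proof.
by apply/funext => e; rewrite coef_mul dof_lincomb//; exact: affinev_hat3.
Qed.

Lemma curl_grad (p : sfield M) : Hgrad Om p -> @curl R M (@grad R M p) = fun _ _ => 0.
Proof.
move=> [ap _ _]; apply/funext => t; apply/funext => x; rewrite /curl /grad.
apply/rowP => k; rewrite curlfE.
have gc i : gradf (fun y => gradf (p t) y 0 i) x = 0.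
  apply: (@gradf_affine _ _ (gradf (p t) 0 0 i)) => y.
  by rewrite dotv0l addr0 (gradf_cst y 0 (ap t)).
by rewrite !gc !mxE subrr.
Qed.

Lemma grad_mx_field (z : 'cV[R]_#|{: ivert}|) :
  ef (Gr *m z) = @grad R M (pfield (coef z)).
Proof.
rewrite /ef coef_grad_mx; apply/funext => t; apply/funext => x.
by apply: (efield_grad triM); exact: Hgrad_pfield.
Qed.

Lemma vL2_0l (v : vfield M) : vL2 (fun _ _ => 0) v = 0.
Proof.
rewrite /vL2 big1// => t _; under eq_fun do rewrite dotv0l.
by rewrite integral3_cst ?mul0r//; apply: region_elt;
  [exact: (tet_injP triM)|exact: (tet_freeP triM)].
Qed.

(** The curl term vanishes on gradients, which leaves the factor eps; at eps = 0 gradients are in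
    the kernel of A. *)
Lemma bform_grad_mx (z : 'cV[R]_#|{: ivert}|) u : bform A (Gr *m z) u
  = eps * vL2 (@grad R M (pfield (coef z))) (ef u).
Proof.
rewrite (bform_curl triM) -!/(ef _) grad_mx_field curl_grad ?vL2_0l ?add0r//.
exact: Hgrad_pfield.
Qed.

Lemma grad_mx_energy z : bform A (Gr *m z) (Gr *m z) <= 1 * bform (eps *: Ag) z z.
Proof.
rewrite bform_grad_mx grad_mx_field bformZm (bform_grad triM) mul1r.
by rewrite ler_wpM2l// lerDl mulr_ge0 ?sL2_ge0.
Qed.

Lemma Pi_mx_energy z : bform A (Pi *m z) (Pi *m z) <= interp_const sigma * bform A3 z z.
Proof.
rewrite (bform_curl triM) (bform_grad3 triM) coef_Pi_mx.
apply: (interp_energy_le triM diamH shape eps01).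
exact: Hgrad3_p3field.
Qed.

Lemma D_curl_energy u : bform A (1%:M *m u) (1%:M *m u) <= 16 * bform D u u.
Proof.
rewrite mul1mx (@bform_D_curl R Om M eps u).
exact: (A_curl_le_diag triM eps01).
Qed.

(** The bound on w and psi is used with factor 16 |diag_const| + 1 and the bound on p once; the
    final 1 makes the constant positive. *)
Definition stable_const : R := (16 * `|diag_const sigma H| + 2) * `|CR| + 1.

Lemma stable_const_gt0 : 0 < stable_const.
Proof. by rewrite ltr_wpDl// mulr_ge0// addr_ge0// mulr_ge0. Qed.

Lemma stable_decomposition u : exists zw zv zp,
  u = 1%:M *m zw + Pi *m zv + Gr *m zp /\
  bform D zw zw + bform A3 zv zv + bform (eps *: Ag) zp zp
    <= stable_const * bform A u u.
Proof.
have vH : Hcurl Om (ef u) := Hcurl_efield triM _.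
have [w [psi [p [[wH [psiH pH]] vE ineq1 ineq2]]]] := regdec vH.
pose zw : 'cV[R]_#|{: iedge}| := \col_a dof (enum_val a) w.
pose zv : 'cV[R]_#|{: ivert * 'I_3}| :=
  \col_a nodal (Defs.comp (enum_val a).2 psi) (enum_val a).1.
pose zp : 'cV[R]_#|{: ivert}| := \col_a nodal p (enum_val a).
have cw : coef zw = fun e => dof e w by exact: (coef_col (fun e => dof e w)).
have cv : p3field (coef zv) = psi.
  rewrite (_ : coef zv = fun ik => nodal (Defs.comp ik.2 psi) ik.1).
    by rewrite -(Hgrad3_nodal triM).
  exact: (coef_col (fun ik => nodal (Defs.comp ik.2 psi) ik.1)).
have cp : pfield (coef zp) = p.
  by rewrite (_ : coef zp = nodal p); [rewrite -(Hgrad_nodal triM)|exact: coef_col].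
have aw := affinev_Hcurl wH; have [ap _ _] := pH.
exists zw, zv, zp; split.
  (* The coefficients of a finite element field are its degrees of freedom, so [dof] is applied to
     the decomposition edge by edge. *)
  apply/colP => a; rewrite mul1mx.
  have cE (y : 'cV[R]_#|{: iedge}|) : y a 0 = coef y (enum_val a).
    by rewrite /coef enum_valK.
  rewrite [RHS]mxE [X in _ = X + _]mxE (cE zw) cw (cE u).
  have eu : coef u (enum_val a) = dof (enum_val a) (ef u) by rewrite (dof_efield triM).
  have eP : (Pi *m zv) a 0 = dof (enum_val a) (Pi_curl Om psi).
    by rewrite cE coef_Pi_mx cv [in RHS](dof_efield triM).
  have eG : (Gr *m zp) a 0 = dof (enum_val a) (grad p).
    by rewrite cE coef_grad_mx cp.
  rewrite eP eG eu.
  have aP t : affinev (Pi_curl Om psi t) := affinev_efield _ t.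
  have ag t : affinev (@grad R M p t) := affinev_grad (ap t).
  rewrite -dofD// -dofD//.
    by congr dof; apply/funext => t; apply/funext => x; exact: vE.
  move=> t k; have [g _] := affineD2 1 1 (aw t k) (aP t k).
  rewrite (_ : (fun x => _) = fun x => 1 * w t x 0 k + 1 * Pi_curl Om psi t x 0 k)//.
  by apply/funext => x; rewrite !mul1r mxE.
rewrite bformZm (@bform_D_curl R Om M eps zw) (bform_grad triM) (bform_grad3 triM) cv cp.
rewrite (bform_curl triM) cw -/(ef u).
have d := dof_diag_le triM H_ge0 diamH shape eps01 wH.
apply: (le_trans (lerD (lerD d (lexx _)) (lexx _))).
have k0 := normr_ge0 (diag_const sigma H).
move: ineq1 ineq2; rewrite /Hcurl_normsq /vH1_normsq /sH1_normsq.
have hw0 : 0 <= hinv_normsq w by exact: vL2_ge0.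
have := vL2_ge0 (@curl R M (ef u)); have := vL2_ge0 (ef u).
have := vL2_ge0 psi; have := grad3L2_ge0 psi.
have := sL2_ge0 p; have := vL2_ge0 (@grad R M p).
move: (hinv_normsq w) (vL2 (curl _) _) (vL2 (ef u) _) (vL2 psi _) (grad3L2 psi _)
  (sL2 p _) (vL2 (grad p) _) hw0 k0 => hw Q N P g s G hw0 k0 G0 s0 g0 P0 N0 Q0 i1 i2.
rewrite /stable_const; move: `|diag_const _ _| k0 => K K0.
have eP : eps * P <= P by rewrite ler_piMl.
have es : eps * s <= s by rewrite ler_piMl.
have i1' : hw + (P + g) <= `|CR| * Q.
  by apply: (le_trans i1); rewrite ler_wpM2r// ler_norm.
(* The H(curl) norm in the bound on p becomes the energy norm through the weight eps, by eps Q <=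
   Q. *)
have i2' : eps * (s + G) <= `|CR| * (Q + eps * N).
  apply: (@le_trans _ _ (eps * (`|CR| * (N + Q)))).
    rewrite ler_wpM2l//; apply: (le_trans i2); rewrite ler_wpM2r ?addr_ge0// ler_norm//.
  rewrite mulrCA ler_wpM2l// mulrDr addrC lerD2r ler_piMl//.
have e1 : 16 * K * hw + (g + eps * P) <= (16 * K + 1) * (`|CR| * Q).
  apply: (@le_trans _ _ ((16 * K + 1) * (hw + (P + g)))).
    have : 0 <= K * (P + g) by rewrite mulr_ge0// addr_ge0.
    lra.
  by rewrite ler_wpM2l// addr_ge0// mulr_ge0.
have e2 : eps * (G + eps * s) <= `|CR| * (Q + eps * N).
  by apply: le_trans i2'; rewrite ler_wpM2l// addrC lerD2r.
have QN : `|CR| * Q <= `|CR| * (Q + eps * N).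
  by rewrite ler_wpM2l// lerDl mulr_ge0.
have e3 : (16 * K + 1) * (`|CR| * Q) <= (16 * K + 1) * (`|CR| * (Q + eps * N)).
  by rewrite ler_wpM2l// addr_ge0// mulr_ge0.
have e4 : 0 <= Q + eps * N by rewrite addr_ge0// mulr_ge0.
apply: (le_trans (lerD e1 e2)); apply: (le_trans (lerD e3 (lexx _))).
rewrite -subr_ge0 (_ : _ - _ = Q + eps * N)//; ring.
Qed.

Lemma kappa_B_curl :
  kappa (B_curl Om M eps *m A) <= (17 + interp_const sigma) * stable_const.
Proof.
have pD := posdef_D_curl triM shape eps01.
have p3 := posdef_A_grad3 opOm triM shape eps01.
have pg := posdef_A_grad opOm triM shape eps01.
have i0 : 0 < interp_const sigma.
  rewrite /interp_const (_ : sigma ^+ 4 = (sigma ^+ 2) ^+ 2); last by ring.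
  apply: ltr_wpDl ltr01; exact: (addr_ge0 (mulr_ge0 (ler0n R 1024) (normr_ge0 _))
    (mulr_ge0 (ler0n R 1024) (sqr_ge0 _))).
(* The Jacobi smoother is the correction with S the identity. *)
pose BD := 1%:M *m invmx D *m (1%:M)^T.
pose BP := Pi *m invmx A3 *m Pi^T.
have C0 := stable_const_gt0.
have C0V : 0 < stable_const^-1 by rewrite invr_gt0.
have up u : bform BD (A *m u) (A *m u) + bform BP (A *m u) (A *m u)
    <= (16 + interp_const sigma) * bform A u u.
  rewrite mulrDl lerD//.
    apply: (correction_upper A_curl_sym A_curl_ge0 pD); last exact: D_curl_energy.
    exact: ltr0n.
  by apply: (correction_upper A_curl_sym A_curl_ge0 p3); last exact: Pi_mx_energy.
have BDE : invmx D = BD by rewrite /BD trmx1 mulmx1 mul1mx.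
have [eps_gt0|eps_le0] := ltP 0 eps.
  have pge := posdefZ eps_gt0 pg.
  (* The factor eps^-1 is moved into the inverse, so that this summand is a correction with K = eps
     A_grad. *)
  pose BG := Gr *m invmx (eps *: Ag) *m Gr^T.
  have -> : B_curl Om M eps = BD + BP + BG.
    rewrite /B_curl eps_gt0 BDE; congr (_ + _).
    rewrite /BG invmxZ ?unitfE ?gt_eqF//; last exact: posdef_unit.
    by rewrite -scalemxAr -scalemxAl.
  apply: kappa_le => //; first exact: A_curl_sym.
  - by rewrite !linearD /= !correction_sym.
  - exact: A_curl_ge0.
  - by rewrite addr_ge0// ltW.
  - move=> u; rewrite !bformDm.
    have [zw [zv [zp [uE st]]]] := stable_decomposition u.
    (* With t = stable_const^-1 the K-energies of the splitting add up to at most (A u, u), which is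
       absorbed by the 2 (A u, u) on the left. *)
    have l1 := correction_lower A 1%:M pD u zw C0V; rewrite -/BD invrK in l1.
    have l2 := correction_lower A Pi p3 u zv C0V; rewrite -/BP invrK in l2.
    have l3 := correction_lower A Gr pge u zp C0V; rewrite -/BG invrK in l3.
    have eA : bform A u u = bform A (1%:M *m zw) u + bform A (Pi *m zv) u
        + bform A (Gr *m zp) u by rewrite -!bformDl -uE.
    have st' := st; rewrite -ler_pdivrMl// in st'.
    lra.
  - move=> u; rewrite !bformDm.
    have : bform BG (A *m u) (A *m u) <= 1 * bform A u u.
      apply: (correction_upper A_curl_sym A_curl_ge0 pge); first exact: ltr01.
      exact: grad_mx_energy.
    have := up u; lra.
have e0 : eps = 0 by apply/le_anti; rewrite eps_le0.
have -> : B_curl Om M eps = BD + BP by rewrite /B_curl ltNge eps_le0 /= BDE.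
apply: kappa_le => //; first exact: A_curl_sym.
- by rewrite !linearD /= !correction_sym.
- exact: A_curl_ge0.
- by rewrite addr_ge0// ltW.
- move=> u; rewrite !bformDm.
  have [zw [zv [zp [uE st]]]] := stable_decomposition u.
  have l1 := correction_lower A 1%:M pD u zw C0V; rewrite -/BD invrK in l1.
  have l2 := correction_lower A Pi p3 u zv C0V; rewrite -/BP invrK in l2.
  (* At eps = 0 the gradient part of the splitting pairs to zero with u, so its missing correction
     is not missed. *)
  have eA : bform A u u = bform A (1%:M *m zw) u + bform A (Pi *m zv) u.
    by rewrite {1}uE !bformDl bform_grad_mx e0 mul0r addr0.
  have g0 : bform (eps *: Ag) zp zp = 0 by rewrite bformZm e0 mul0r.
  rewrite g0 addr0 -ler_pdivrMl// in st; lra.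
- move=> u; rewrite !bformDm; apply: (le_trans (up u)).
  by apply: ler_wpM2r; [exact: A_curl_ge0|rewrite lerD2r ler_nat].
Qed.

End Preconditioner.

Theorem theorem7p1 (R : realType) (Omega : set 'rV[R]_3)
    (hOmega : polyhedral_domain Omega) (sigma tau CR : R) :
  exists C : R,
    forall (I : Type) (T : I -> mesh R),
      quasi_uniform_family Omega T sigma tau ->
      (forall i, regular_decomposition Omega (T i) CR) ->
      forall (i : I) (eps : R), 0 <= eps <= 1 ->
        A_curl Omega (T i) eps != 0 ->
        kappa (B_curl Omega (T i) eps *m A_curl Omega (T i) eps) <= C.
Proof.
have [_ opO _ bO _] := hOmega.
have [H H0 hH] := triangulated_diam_bound bO.
(* 17 = 16 + 1: the Jacobi and gradient corrections. All ingredients are fixed before the family of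
   meshes and eps. *)
exists ((17 + interp_const sigma) * stable_const sigma H CR).
move=> I T qu rd i eps eps01 _.
have [tri [shape _]] := qu i.
apply: kappa_B_curl => // t x y; exact: hH.
Qed.
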